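(* Let $K$ be a field. Then the diagram $\vec{L}^{\mathrm{u}}$ has a lifting, with respect to the functor $\mathrm{V}^1$, by unital exchange algebras over $K$. Explicitly, there are unital exchange $K$-algebras $A,B,C,D$ and unital homomorphisms of $K$-algebras $e\colon A\to B$, $s\colon B\to B$, $f,g\colon B\to C$, $h\colon C\to D$, $v\colon D\to D$ such that $$f\circ e=g\circ e,\quad s\circ e=e,\quad h\circ f\circ s=v\circ h\circ f,\quad v\circ h\circ g=h\circ g,$$ $s$ and $v$ are both involutive automorphisms, and there are isomorphisms of monoids with order-unit $$\eta_A\colon(\mathrm{V}(A),[1_A])\to(\mathbb{Z}^+,1),\quad \eta_B\colon(\mathrm{V}(B),[1_B])\to(\mathbb{Z}^+\times\mathbb{Z}^+,(1,1)),$$ $$\eta_C\colon(\mathrm{V}(C),[1_C])\to(\mathbb{Z}^+\times\mathbb{Z}^+,(1,1)),\quad \eta_D\colon(\mathrm{V}(D),[1_D])\to(\mathbb{Z}^+,2)$$ with $\eta_B\mathrm{V}(e)=\boldsymbol{e}\,\eta_A$, $\eta_B\mathrm{V}(s)=\boldsymbol{s}\,\eta_B$, $\eta_C\mathrm{V}(f)=\eta_C\mathrm{V}(g)=\eta_B$, $\eta_D\mathrm{V}(h)=\boldsymbol{h}\,\eta_C$, and $\eta_D\mathrm{V}(v)=\eta_D$.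
   Context: $\mathbb{Z}^+=\{0,1,2,\dots\}$; $\boldsymbol{e}(x)=(x,x)$, $\boldsymbol{s}(x,y)=(y,x)$, $\boldsymbol{h}(x,y)=x+y$ for $x,y\in\mathbb{Z}^+$. The diagram $\vec{L}^{\mathrm{u}}$ consists of the vertices $(\mathbb{Z}^+,1)$, $(\mathbb{Z}^+\times\mathbb{Z}^+,(1,1))$ (twice), $(\mathbb{Z}^+,2)$, with arrow $\boldsymbol{e}$ from the first to the second vertex, the loop $\boldsymbol{s}$ on the second vertex, two arrows from the second to the third vertex, both equal to the identity, the arrow $\boldsymbol{h}$ from the third to the fourth vertex, and the identity as a loop on the fourth vertex. A ring $R$ is an exchange ring if for every $x\in R$ there are an idempotent $e\in R$ and $r,s\in R$ such that $e=rx=x+s-sx$. An automorphism is involutive if its square is the identity. For a ring $R$, $\mathrm{V}(R)$ is the commutative monoid of equivalence classes $[a]_R$ of idempotents $a$ of $\mathrm{M}_\infty(R)=\bigcup_n\mathrm{M}_n(R)$ (embedding $\mathrm{M}_n(R)$ into $\mathrm{M}_{n+1}(R)$ by adding a zero row and column), where $a\sim b$ if $a=xy$, $b=yx$ for some $x,y\in\mathrm{M}_\infty(R)$, with addition determined by $[a]_R+[b]_R=[a+b]_R$ whenever $ab=ba=0$. A ring homomorphism $f\colon R\to S$ induces $\mathrm{V}(f)\colon[a]_R\mapsto[f(a)]_S$. For unital $R$, $\mathrm{V}^1(R)=(\mathrm{V}(R),[1_R])$. Isomorphisms of monoids with order-unit are monoid isomorphisms sending the order-unit to the order-unit. *)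

(* Defs.v *)
From HB Require Import structures.
From mathcomp Require Import all_boot all_algebra.
From mathcomp Require Import all_classical.

Set Implicit Arguments.
Unset Strict Implicit.
Unset Printing Implicit Defensive.

Import GRing.Theory.
Local Open Scope ring_scope.
Local Open Scope quotient_scope.

Definition exchange_ring (R : pzRingType) : Prop :=
  forall x : R, exists e r s : R,
    [/\ e * e = e, e = r * x & e = x + s - s * x].

(* The union of the M_n(R), for the embeddings that add a zero row and a zero
   column: the matrices indexed by nat x nat that vanish outside some
   {0, ..., n-1} x {0, ..., n-1}. *)
Record Minf (R : pzRingType) := MkMinf {
  minf_fun :> nat -> nat -> R;
  minf_bounded : exists n, forall i j,
    (n <= i)%N || (n <= j)%N -> minf_fun i j = 0 }.

HB.instance Definition _ (R : pzRingType) := gen_eqMixin (Minf R).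
HB.instance Definition _ (R : pzRingType) := gen_choiceMixin (Minf R).

Lemma minf_ext (R : pzRingType) (a b : Minf R) :
  (forall i j, a i j = b i j) -> a = b.
Proof.
case: a b => [a pa] [b pb] /= ab.
have eab : a = b by apply/funext => i; apply/funext => j; apply: ab.
by rewrite eab in pa *; congr MkMinf; apply: Prop_irrelevance.
Qed.

Lemma half_le n : (n./2 <= n)%N.
Proof. by rewrite leq_half_double -addnn leqW // leq_addr. Qed.

Lemma sum_double (R : pzRingType) (F : nat -> R) N :
  \sum_(j < N.*2) F j = \sum_(j < N) (F j.*2 + F j.*2.+1).
Proof.
elim: N => [|N IH]; first by rewrite !big_ord0.
by rewrite doubleS !big_ord_recr /= IH addrA.
Qed.

Section MinfOps.
Variable R : pzRingType.
Implicit Types a b c d : Minf R.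

Lemma minf_mx_subproof n (A : 'M[R]_n) : exists m, forall i j,
  (m <= i)%N || (m <= j)%N ->
  (if insub i is Some i' then
     if insub j is Some j' then A i' j' else 0 else 0) = 0.
Proof.
exists n => i j ij; case: insubP => [i' lti _|//]; case: insubP => [j' ltj _|//].
by move: ij; rewrite leqNgt lti leqNgt ltj.
Qed.
Definition minf_mx n (A : 'M[R]_n) : Minf R := MkMinf (minf_mx_subproof A).

Definition minf0 : Minf R := minf_mx (0 : 'M_0).

Lemma minf_bound3 a b c : exists N, forall i j, (N <= i)%N || (N <= j)%N ->
  [/\ a i j = 0, b i j = 0 & c i j = 0].
Proof.
have [n an] := minf_bounded a; have [m bm] := minf_bounded b.
have [p cp] := minf_bounded c.
exists (maxn n (maxn m p)) => i j; rewrite !geq_max => ij.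
by split; [apply: an|apply: bm|apply: cp];
  case/orP: ij => /and3P[ni mi pi]; apply/orP; by [left|right].
Qed.

Lemma minf_add_subproof a b : exists n, forall i j,
  (n <= i)%N || (n <= j)%N -> a i j + b i j = 0.
Proof.
have [n ab0] := minf_bound3 a b b.
by exists n => i j /ab0[-> -> _]; rewrite addr0.
Qed.
Definition minf_add a b : Minf R := MkMinf (minf_add_subproof a b).

Lemma minf_mul_subproof a b : exists n, forall i k,
  (n <= i)%N || (n <= k)%N -> \sum_(j \in [set: nat]) a i j * b j k = 0.
Proof.
have [n ab0] := minf_bound3 a b b.
exists n => i k /orP[ni|nk]; apply: fsbig1 => j _.
  by have [|-> _ _] := ab0 i j; rewrite ?ni ?mul0r.
by have [|_ -> _] := ab0 j k; rewrite ?nk ?orbT ?mulr0.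
Qed.
Definition minf_mul a b : Minf R := MkMinf (minf_mul_subproof a b).

Definition minf_idem a : Prop := minf_mul a a = a.

(* The 2 x 2 block matrix [[a, b], [c, d]], with rows and columns interleaved:
   the even indices form the first block and the odd ones the second block, so
   that no size has to be chosen. *)
Lemma minf_blk_subproof a b c d : exists n, forall i j,
  (n <= i)%N || (n <= j)%N ->
  (if odd i then if odd j then d else c else if odd j then b else a)
    i./2 j./2 = 0.
Proof.
have [n1 h1] := minf_bound3 a b c; have [n2 h2] := minf_bounded d.
exists (maxn n1 n2).*2 => i j.
rewrite -!geq_half_double !geq_max => /orP[/andP[k1 k2]|/andP[k1 k2]].
  by have [|? ? ?] := h1 i./2 j./2; rewrite ?k1//;
    case: (odd i); case: (odd j) => //; rewrite h2 ?k2.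
by have [|? ? ?] := h1 i./2 j./2; rewrite ?k1 ?orbT//;
  case: (odd i); case: (odd j) => //; rewrite h2 ?k2 ?orbT.
Qed.
Definition minf_blk a b c d : Minf R := MkMinf (minf_blk_subproof a b c d).

Definition minf_osum a b : Minf R := minf_blk a minf0 minf0 b.

Lemma minf_row_subproof a b : exists n, forall i j,
  (n <= i)%N || (n <= j)%N -> (if odd j then b else a) i j./2 = 0.
Proof.
have [n h] := minf_bound3 a b b.
exists n.*2 => i j; rewrite -!geq_half_double => ij.
have [|? ? _] := h i j./2; last by case: (odd j).
case/orP: ij => [ni|->]; last by rewrite orbT.
by apply/orP; left; apply: leq_trans ni (half_le i).
Qed.
Definition minf_row a b : Minf R := MkMinf (minf_row_subproof a b).

Lemma minf_col_subproof a b : exists n, forall i j,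
  (n <= i)%N || (n <= j)%N -> (if odd i then b else a) i./2 j = 0.
Proof.
have [n h] := minf_bound3 a b b.
exists n.*2 => i j; rewrite -!geq_half_double => ij.
have [|? ? _] := h i./2 j; last by case: (odd i).
case/orP: ij => [->//|nj].
by apply/orP; right; apply: leq_trans nj (half_le j).
Qed.
Definition minf_col a b : Minf R := MkMinf (minf_col_subproof a b).

Lemma minf_mulE a b N i k : (forall j, (N <= j)%N -> a i j * b j k = 0) ->
  minf_mul a b i k = \sum_(j < N) a i j * b j k.
Proof.
move=> abN; rewrite (fsbig_ord _ _ (fun j => a i j * b j k)).
by apply/esym/fsbig_widen => // j [_ /negP]; rewrite -leqNgt => /abN.
Qed.

Lemma minf_mulA a b c : minf_mul a (minf_mul b c) = minf_mul (minf_mul a b) c.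
Proof.
have [N bN] := minf_bound3 a b c; apply: minf_ext => i l.
rewrite (@minf_mulE _ _ N); last first.
  by move=> j Nj; have [|-> _ _] := bN i j; rewrite ?Nj ?orbT ?mul0r.
rewrite (@minf_mulE _ _ N); last first.
  by move=> j Nj; have [|_ _ ->] := bN j l; rewrite ?Nj ?mulr0.
transitivity (\sum_(j < N) \sum_(k < N) a i j * b j k * c k l).
  apply: eq_bigr => j _; rewrite (@minf_mulE _ _ N).
    by rewrite mulr_sumr; apply: eq_bigr => k _; rewrite mulrA.
  by move=> k Nk; have [|_ -> _] := bN j k; rewrite ?Nk ?orbT ?mul0r.
rewrite exchange_big; apply: eq_bigr => k _; rewrite (@minf_mulE _ _ N).
  by rewrite mulr_suml.
by move=> j Nj; have [|-> _ _] := bN i j; rewrite ?Nj ?orbT ?mul0r.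
Qed.

(* The elements of Minf are the matrices of M_n(R), identified along the
   embeddings of M_n(R) into M_{n+1}(R), with the products of the M_n(R). *)
Lemma minf_mx_surj a : exists n (A : 'M[R]_n), a = minf_mx A.
Proof.
have [n an] := minf_bounded a; exists n, (\matrix_(i, j) a i j).
apply: minf_ext => i j /=.
case: insubP => [i' _ <-|]; last by rewrite -leqNgt => ni; rewrite an ?ni.
case: insubP => [j' _ <-|]; first by rewrite mxE.
by rewrite -leqNgt => nj; rewrite an ?nj ?orbT.
Qed.

Lemma minf_mx_inj n : injective (@minf_mx n).
Proof.
move=> A B AB; apply/matrixP => i j.
by move: (congr1 (fun a : Minf R => a i j) AB); rewrite /= !valK.
Qed.

Lemma minf_mx_block n (A : 'M[R]_n) :
  minf_mx (block_mx A 0 0 0 : 'M_(n + 1)) = minf_mx A.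
Proof.
have key k (k' : 'I_(n + 1)) : val k' = k ->
    insub k = if fintype.split k' is inl p then Some p else None.
  move=> <- /=; case: splitP => p ->; first by rewrite valK.
  by apply: insubN; rewrite -leqNgt leq_addr.
have out k : (n + 1 <= k)%N -> insub k = None :> option 'I_n.
  by move=> nk; apply: insubN; rewrite -leqNgt (leq_trans (leq_addr 1 n)).
apply: minf_ext => i j /=.
case: insubP => [i' _ /key ->|]; last by rewrite -leqNgt => /out ->.
case: insubP => [j' _ /key ->|]; last first.
  by rewrite -leqNgt => /out ->; case: fintype.split.
rewrite /block_mx mxE.
by case: (fintype.split i') => p; rewrite mxE; case: (fintype.split j') => q;
  rewrite ?mxE.
Qed.

Lemma minf_mx_mul n (A B : 'M[R]_n) :
  minf_mul (minf_mx A) (minf_mx B) = minf_mx (A *m B).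
Proof.
apply: minf_ext => i k; rewrite (@minf_mulE _ _ n) => [|j nj]; last first.
  have ej : insub j = None :> option 'I_n by apply: insubN; rewrite -leqNgt.
  by rewrite /= ej mulr0.
rewrite /=; case: (insubP 'I_n i) => [i' _ _|_]; last first.
  by rewrite big1 // => j _; rewrite mul0r.
case: (insubP 'I_n k) => [k' _ _|_]; last first.
  by rewrite big1 // => j _; rewrite valK mulr0.
by rewrite mxE; apply: eq_bigr => j _; rewrite !valK.
Qed.

Lemma minf0E i j : minf0 i j = 0.
Proof. by rewrite /=; case: insubP => // -[]. Qed.

Lemma minf_mul0l a : minf_mul minf0 a = minf0.
Proof.
by apply: minf_ext => i j; rewrite (@minf_mulE _ _ 0) ?big_ord0 ?minf0E// => k _;
  rewrite minf0E mul0r.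
Qed.

Lemma minf_mul0r a : minf_mul a minf0 = minf0.
Proof.
by apply: minf_ext => i j; rewrite (@minf_mulE _ _ 0) ?big_ord0 ?minf0E// => k _;
  rewrite minf0E mulr0.
Qed.

Lemma minf_blkE a b c d i j : minf_blk a b c d i j =
  (if odd i then if odd j then d else c else if odd j then b else a) i./2 j./2.
Proof. by []. Qed.

Lemma minf_rowE a b i j : minf_row a b i j = (if odd j then b else a) i j./2.
Proof. by []. Qed.

Lemma minf_colE a b i j : minf_col a b i j = (if odd i then b else a) i./2 j.
Proof. by []. Qed.

Lemma minf_osum0 : minf_osum minf0 minf0 = minf0.
Proof.
by apply: minf_ext => i j; rewrite minf_blkE !if_same !minf0E.
Qed.

Lemma minf_addE a b i j : minf_add a b i j = a i j + b i j.
Proof. by []. Qed.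

Lemma minf_add0l a : minf_add minf0 a = a.
Proof. by apply: minf_ext => i j; rewrite minf_addE minf0E add0r. Qed.

Lemma minf_add0r a : minf_add a minf0 = a.
Proof. by apply: minf_ext => i j; rewrite minf_addE minf0E addr0. Qed.

Lemma minf_addA a b c : minf_add a (minf_add b c) = minf_add (minf_add a b) c.
Proof. by apply: minf_ext => i j; rewrite !minf_addE addrA. Qed.

Lemma minf_bound_col a b c d : exists N, forall i j, (N <= j)%N ->
  [/\ a i j = 0, b i j = 0, c i j = 0 & d i j = 0].
Proof.
have [N1 h1] := minf_bound3 a b c; have [N2 h2] := minf_bound3 d d d.
exists (maxn N1 N2) => i j; rewrite geq_max => /andP[j1 j2].
have [|-> -> ->] := h1 i j; first by rewrite j1 orbT.
by have [|-> _ _] := h2 i j; first by rewrite j2 orbT.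
Qed.

Lemma minf_blk_mul a b c d a' b' c' d' :
  minf_mul (minf_blk a b c d) (minf_blk a' b' c' d') =
  minf_blk (minf_add (minf_mul a a') (minf_mul b c'))
           (minf_add (minf_mul a b') (minf_mul b d'))
           (minf_add (minf_mul c a') (minf_mul d c'))
           (minf_add (minf_mul c b') (minf_mul d d')).
Proof.
have [N h] := minf_bound_col a b c d.
have mE x y i k : [\/ x = a, x = b, x = c | x = d] ->
    minf_mul x y i k = \sum_(j < N) x i j * y j k.
  move=> xE; apply: minf_mulE => j /(h i)[ha hb hc hd].
  by case: xE => ->; rewrite ?ha ?hb ?hc ?hd mul0r.
apply: minf_ext => i k; rewrite (@minf_mulE _ _ N.*2) => [|j]; last first.
  rewrite -geq_half_double => /(h i./2) [ha hb hc hd]; rewrite minf_blkE.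
  by case: (odd i); case: (odd j); rewrite ?ha ?hb ?hc ?hd mul0r.
rewrite (@sum_double _ (fun j => minf_blk a b c d i j * minf_blk a' b' c' d' j k)).
rewrite big_split /=.
under eq_bigr do rewrite odd_double doubleK.
under [X in _ + X]eq_bigr do rewrite odd_double uphalf_double.
by case: (odd i); case: (odd k); rewrite minf_addE !mE //; by constructor.
Qed.

Lemma minf_osum_mul a b a' b' :
  minf_mul (minf_osum a b) (minf_osum a' b') =
  minf_osum (minf_mul a a') (minf_mul b b').
Proof.
by rewrite minf_blk_mul !minf_mul0l !minf_mul0r !minf_add0l !minf_add0r.
Qed.

Lemma minf_osum_add a b a' b' :
  minf_add (minf_osum a b) (minf_osum a' b') =
  minf_osum (minf_add a a') (minf_add b b').
Proof.
apply: minf_ext => i j; rewrite !(minf_addE, minf_blkE).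
by case: (odd i); case: (odd j); rewrite ?minf_addE ?minf0E ?addr0.
Qed.

Lemma minf_row_col a b a' b' : minf_mul (minf_row a b) (minf_col a' b') =
  minf_add (minf_mul a a') (minf_mul b b').
Proof.
have [N h] := minf_bound_col a b a b.
apply: minf_ext => i k; rewrite (@minf_mulE _ _ N.*2) => [|j]; last first.
  rewrite -geq_half_double => /(h i) [ha hb _ _]; rewrite minf_rowE.
  by case: (odd j); rewrite ?ha ?hb mul0r.
rewrite (@sum_double _ (fun j => minf_row a b i j * minf_col a' b' j k)).
rewrite big_split minf_addE !(@minf_mulE _ _ N); last 2 first.
- by move=> j /(h i)[_ -> _ _]; rewrite mul0r.
- by move=> j /(h i)[-> _ _ _]; rewrite mul0r.
by congr (_ + _); apply: eq_bigr => j _;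
  rewrite minf_rowE minf_colE /= odd_double ?doubleK ?uphalf_double.
Qed.

Lemma minf_col_row a b a' b' : minf_mul (minf_col a b) (minf_row a' b') =
  minf_blk (minf_mul a a') (minf_mul a b') (minf_mul b a') (minf_mul b b').
Proof.
have [N h] := minf_bound_col a b a b.
apply: minf_ext => i k; rewrite (@minf_mulE _ _ N) => [|j]; last first.
  move=> /(h i./2)[ha hb _ _]; rewrite minf_colE.
  by case: (odd i); rewrite ?ha ?hb mul0r.
rewrite minf_blkE.
under eq_bigr do rewrite minf_colE minf_rowE.
case: (odd i); case: (odd k); rewrite (@minf_mulE _ _ N) // => j;
  by move=> /(h i./2)[ha hb _ _]; rewrite ?ha ?hb mul0r.
Qed.

Definition idem_equiv a b : Prop :=
  exists x y, a = minf_mul x y /\ b = minf_mul y x.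

Lemma idem_equiv_sym a b : idem_equiv a b -> idem_equiv b a.
Proof. by case=> x [y [-> ->]]; exists y, x. Qed.

Lemma idem_equiv_trans a b c : minf_idem a -> minf_idem c ->
  idem_equiv a b -> idem_equiv b c -> idem_equiv a c.
Proof.
move=> ia ic [x [y [aE bE]]] [z [w [bE' cE]]].
exists (minf_mul x z), (minf_mul w y); split.
  rewrite -[LHS]ia {1}aE -minf_mulA aE minf_mulA -[RHS]minf_mulA.
  by rewrite [minf_mul z _]minf_mulA -bE' bE !minf_mulA.
rewrite -[LHS]ic {1}cE -minf_mulA cE minf_mulA -[RHS]minf_mulA.
by rewrite [minf_mul y _]minf_mulA -bE bE' !minf_mulA.
Qed.

End MinfOps.

Record Idem (R : pzRingType) := MkIdem {
  idem_val :> Minf R; idemP : minf_idem idem_val }.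

HB.instance Definition _ (R : pzRingType) := gen_eqMixin (Idem R).
HB.instance Definition _ (R : pzRingType) := gen_choiceMixin (Idem R).

Lemma idem_ext (R : pzRingType) (a b : Idem R) : a = b :> Minf R -> a = b.
Proof.
case: a b => [a pa] [b pb] /= ab; rewrite ab in pa *.
by congr MkIdem; apply: Prop_irrelevance.
Qed.

Section V.
Variable R : pzRingType.
Implicit Types a b c : Idem R.

Definition idem_equivb a b : bool := `[< idem_equiv a b >].

Lemma idem_equivb_refl : reflexive idem_equivb.
Proof. by move=> a; apply/asboolP; exists a, a; rewrite idemP. Qed.

Lemma idem_equivb_sym : symmetric idem_equivb.
Proof. by move=> a b; apply/asboolP/asboolP => /idem_equiv_sym. Qed.

Lemma idem_equivb_trans : transitive idem_equivb.
Proof.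
move=> b a c /asboolP ab /asboolP bc; apply/asboolP.
exact: idem_equiv_trans (idemP a) (idemP c) ab bc.
Qed.

Canonical idem_equiv_rel :=
  EquivRel idem_equivb idem_equivb_refl idem_equivb_sym idem_equivb_trans.

Definition V := {eq_quot idem_equivb}.
HB.instance Definition _ := Choice.on V.
HB.instance Definition _ := EqQuotient.on V.

Definition Vclass a : V := \pi_V a.

Lemma VclassP a b : Vclass a = Vclass b <-> idem_equiv a b.
Proof.
split => [/eqP|ab]; last by apply/eqP; rewrite eqmodE; apply/asboolP.
by rewrite eqmodE => /asboolP.
Qed.

Lemma VclassK (u : V) : Vclass (repr u) = u.
Proof. exact: reprK. Qed.

Lemma idem0_subproof : minf_idem (minf0 R).
Proof. exact: minf_mul0l. Qed.
Definition idem0 : Idem R := MkIdem idem0_subproof.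

Lemma idem1_subproof : minf_idem (minf_mx (1%:M : 'M[R]_1)).
Proof. by rewrite /minf_idem minf_mx_mul mul1mx. Qed.
Definition idem1 : Idem R := MkIdem idem1_subproof.

Lemma idem_osum_subproof a b : minf_idem (minf_osum a b).
Proof. by rewrite /minf_idem minf_osum_mul !idemP. Qed.
Definition idem_osum a b : Idem R := MkIdem (idem_osum_subproof a b).

Definition V_unit : V := Vclass idem1.
Definition V_zero : V := Vclass idem0.
Definition V_add (u w : V) : V := Vclass (idem_osum (repr u) (repr w)).

Lemma Vclass_osum a b : V_add (Vclass a) (Vclass b) = Vclass (idem_osum a b).
Proof.
have /VclassP[x [y [aE aE']]] := VclassK (Vclass a).
have /VclassP[z [w [bE bE']]] := VclassK (Vclass b).
apply/VclassP; exists (minf_osum x z), (minf_osum y w).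
by rewrite !minf_osum_mul -aE -aE' -bE -bE'.
Qed.

(* V_add_orth and V_orth_repr characterize V_add: it is the unique operation
   with [a] + [b] = [a + b] for orthogonal a and b. *)
Lemma V_add_orth a b c :
  minf_mul a b = minf0 R -> minf_mul b a = minf0 R ->
  idem_val c = minf_add a b -> V_add (Vclass a) (Vclass b) = Vclass c.
Proof.
move=> ab ba cE; rewrite Vclass_osum; apply/VclassP/idem_equiv_sym.
exists (minf_row a b), (minf_col a b).
by rewrite minf_row_col minf_col_row ab ba !idemP.
Qed.

Lemma V_addC : commutative V_add.
Proof.
move=> u w; rewrite -(VclassK u) -(VclassK w) !Vclass_osum; apply/VclassP.
set a := repr u; set b := repr w.
exists (minf_blk (minf0 R) a b (minf0 R)), (minf_blk (minf0 R) b a (minf0 R)).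
by rewrite !minf_blk_mul !minf_mul0l !minf_mul0r !minf_add0l !minf_add0r !idemP.
Qed.

Lemma V_add0 : left_id V_zero V_add.
Proof.
move=> u; rewrite -(VclassK u).
by apply: V_add_orth; rewrite /= ?minf_mul0l ?minf_mul0r ?minf_add0l.
Qed.

Lemma V_orth_repr (u w : V) : exists a b,
  [/\ Vclass a = u, Vclass b = w,
      minf_mul a b = minf0 R & minf_mul b a = minf0 R].
Proof.
exists (idem_osum (repr u) idem0), (idem_osum idem0 (repr w)); split.
- by rewrite -Vclass_osum VclassK V_addC V_add0.
- by rewrite -Vclass_osum VclassK V_add0.
- by rewrite minf_osum_mul minf_mul0l minf_mul0r minf_osum0.
- by rewrite minf_osum_mul minf_mul0l minf_mul0r minf_osum0.
Qed.

Lemma V_addA : associative V_add.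
Proof.
move=> u v w; rewrite -(VclassK u) -(VclassK v) -(VclassK w) !Vclass_osum.
set a := repr u; set b := repr v; set c := repr w.
pose a' := idem_osum (idem_osum a idem0) idem0.
pose c' := idem_osum idem0 c.
have aa' : Vclass a = Vclass a'.
  by rewrite -!Vclass_osum -/V_zero ![V_add _ V_zero]V_addC !V_add0.
have bc : Vclass (idem_osum b c) = Vclass (idem_osum (idem_osum idem0 b) c).
  by rewrite -!Vclass_osum -/V_zero V_add0.
rewrite -Vclass_osum bc aa'; apply: V_add_orth => /=.
- by rewrite !minf_osum_mul !minf_mul0l !minf_mul0r !minf_osum0.
- by rewrite !minf_osum_mul !minf_mul0l !minf_mul0r !minf_osum0.
- by rewrite !minf_osum_add !minf_add0l !minf_add0r.
Qed.

HB.instance Definition _ := GRing.isNmodule.Build V V_addA V_addC V_add0.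

End V.

Section Vmap.
Variables (R S : pzRingType) (f : {rmorphism R -> S}).

Lemma minf_map_subproof (a : Minf R) : exists n, forall i j,
  (n <= i)%N || (n <= j)%N -> f (a i j) = 0.
Proof.
by have [n an] := minf_bounded a; exists n => i j /an ->; rewrite rmorph0.
Qed.
Definition minf_map (a : Minf R) : Minf S := MkMinf (minf_map_subproof a).

Lemma minf_mapE a i j : minf_map a i j = f (a i j).
Proof. by []. Qed.

Lemma minf_map_mul a b :
  minf_map (minf_mul a b) = minf_mul (minf_map a) (minf_map b).
Proof.
have [N h] := minf_bound_col a a a a.
apply: minf_ext => i k; rewrite (@minf_mulE _ _ _ N) => [|j]; last first.
  by move=> /(h i)[ha _ _ _]; rewrite minf_mapE ha rmorph0 mul0r.
rewrite minf_mapE (@minf_mulE _ _ _ N).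
  by rewrite rmorph_sum; apply: eq_bigr => j _; rewrite rmorphM.
by move=> j /(h i)[ha _ _ _]; rewrite ha mul0r.
Qed.

Lemma idem_map_subproof (a : Idem R) : minf_idem (minf_map a).
Proof. by rewrite /minf_idem -minf_map_mul idemP. Qed.
Definition idem_map (a : Idem R) : Idem S := MkIdem (idem_map_subproof a).

Definition Vmap (u : V R) : V S := Vclass (idem_map (repr u)).

Lemma Vmap_class a : Vmap (Vclass a) = Vclass (idem_map a).
Proof.
have /VclassP[x [y [aE aE']]] := VclassK (Vclass a).
apply/VclassP; exists (minf_map x), (minf_map y).
by rewrite -!minf_map_mul -aE -aE'.
Qed.

Lemma Vmap_nmod_morphism : nmod_morphism Vmap.
Proof.
split=> [|u w].
  rewrite [LHS]Vmap_class; congr Vclass; apply: idem_ext; apply: minf_ext => i j.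
  by rewrite minf_mapE !minf0E rmorph0.
rewrite -(VclassK u) -(VclassK w) [Vclass _ + _]Vclass_osum !Vmap_class.
rewrite [RHS]Vclass_osum; congr Vclass; apply: idem_ext; apply: minf_ext => i j.
rewrite minf_mapE !minf_blkE.
by case: (odd i); case: (odd j); rewrite ?minf0E ?rmorph0.
Qed.

HB.instance Definition _ :=
  GRing.isNmodMorphism.Build (V R) (V S) Vmap Vmap_nmod_morphism.

End Vmap.

Definition ounit_iso (M N : nmodType) (u : M) (w : N) (eta : {additive M -> N})
    : Prop :=
  bijective eta /\ eta u = w.

Definition Lu_e (x : nat) : nat * nat := (x, x).
Definition Lu_s (p : nat * nat) : nat * nat := (p.2, p.1).
Definition Lu_h (p : nat * nat) : nat := (p.1 + p.2)%N.

(* Main.v *)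
(* Take A = K, B = K x K, D = M_2(K(t)), and let C be the subalgebra of those
   matrices in D whose entries are regular at t = 0 and whose (0, 1) entry
   vanishes there. Both diagonal entries taken at t = 0 give C -> K x K, whose
   kernel is the Jacobson radical, so C is semiperfect with V(C) = N x N.
   The morphisms f and g send (1, 0) to the idempotents

     P = [[1, 0], [0, 0]]   and   Q = [[1 - t, t], [1 - t, t]],

   which agree modulo the radical, whence V(f) = V(g). The free product of two
   copies of K x K embeds in D via P and Q, with (P - Q)^2 = t central; its
   automorphism x |-> 1 - x, y |-> y sends t to 1 - t, and extends to the
   involution v of D which applies t |-> 1 - t to the entries and exchanges
   both indices. Then v(P) = 1 - P and v(Q) = Q, as the relations require.

   The monoids V are computed by splitting off copies of primitive idempotents:
   if some entry x of an idempotent matrix a satisfies y x z = e, then the class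
   of e is a summand of that of a; if no entry does, a has all its entries in the
   Jacobson radical and is zero by Nakayama's lemma. *)

Require Import Defs.
From HB Require Import structures.
From mathcomp Require Import all_boot all_algebra ring.
From mathcomp Require Import boolp.

Set Implicit Arguments.
Unset Strict Implicit.
Unset Printing Implicit Defensive.

Import GRing.Theory.
Local Open Scope ring_scope.

Local Notation "x %:F" := (tofrac x).

(** * Idempotent matrices and generators of V *)

Section MinfCalculus.
Variable R : pzRingType.
Implicit Types a b c : Minf R.

Lemma minf_sub_subproof a b : exists n, forall i j,
  (n <= i)%N || (n <= j)%N -> a i j - b i j = 0.
Proof.
have [n ab0] := minf_bound3 a b b.
by exists n => i j /ab0[-> -> _]; rewrite subr0.
Qed.
Definition minf_sub a b : Minf R := MkMinf (minf_sub_subproof a b).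

Lemma minf_subE a b i j : minf_sub a b i j = a i j - b i j.
Proof. by []. Qed.

Lemma minf_mulBl a b c :
  minf_mul (minf_sub a b) c = minf_sub (minf_mul a c) (minf_mul b c).
Proof.
have [N h] := minf_bound_col a b a b.
apply: minf_ext => i k; rewrite minf_subE !(@minf_mulE _ _ _ N);
  try by move=> j /(h i)[ha hb _ _]; rewrite ?minf_subE ?ha ?hb ?subr0 mul0r.
by rewrite -sumrB; apply: eq_bigr => j _; rewrite minf_subE mulrBl.
Qed.

Lemma minf_mulBr a b c :
  minf_mul a (minf_sub b c) = minf_sub (minf_mul a b) (minf_mul a c).
Proof.
have [N h] := minf_bound_col a a a a.
apply: minf_ext => i k; rewrite minf_subE !(@minf_mulE _ _ _ N);
  try by move=> j /(h i)[ha _ _ _]; rewrite ha mul0r.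
by rewrite -sumrB; apply: eq_bigr => j _; rewrite minf_subE mulrBr.
Qed.

Lemma minf_mulDl a b c :
  minf_mul (minf_add a b) c = minf_add (minf_mul a c) (minf_mul b c).
Proof.
have [N h] := minf_bound_col a b a b.
apply: minf_ext => i k; rewrite minf_addE !(@minf_mulE _ _ _ N);
  try by move=> j /(h i)[ha hb _ _]; rewrite ?minf_addE ?ha ?hb ?addr0 mul0r.
by rewrite -big_split; apply: eq_bigr => j _; rewrite minf_addE mulrDl.
Qed.

Lemma minf_mulDr a b c :
  minf_mul a (minf_add b c) = minf_add (minf_mul a b) (minf_mul a c).
Proof.
have [N h] := minf_bound_col a a a a.
apply: minf_ext => i k; rewrite minf_addE !(@minf_mulE _ _ _ N);
  try by move=> j /(h i)[ha _ _ _]; rewrite ha mul0r.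
by rewrite -big_split; apply: eq_bigr => j _; rewrite minf_addE mulrDr.
Qed.

(** Additivity of a map on V is checked below on such representatives, where the sum is an actual
    sum of matrices. *)
Lemma V_orth_decomp (u w : V R) : exists a b c : Idem R,
  [/\ Vclass a = u, Vclass b = w & u + w = Vclass c] /\
  [/\ minf_mul a b = minf0 R, minf_mul b a = minf0 R &
      idem_val c = minf_add a b].
Proof.
have [a [b [<- <- ab ba]]] := V_orth_repr u w.
have cc : minf_idem (minf_add a b).
  by rewrite /minf_idem minf_mulDl !minf_mulDr !idemP ab ba minf_add0l minf_add0r.
by exists a, b, (MkIdem cc); split; split => //; apply: V_add_orth.
Qed.

Lemma minf_subrr a : minf_sub a a = minf0 R.
Proof. by apply: minf_ext => i j; rewrite minf_subE minf0E subrr. Qed.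

Lemma minf_subr0 a : minf_sub a (minf0 R) = a.
Proof. by apply: minf_ext => i j; rewrite minf_subE minf0E subr0. Qed.

Lemma minf_subKC a b : minf_add b (minf_sub a b) = a.
Proof. by apply: minf_ext => i j; rewrite minf_addE minf_subE addrC subrK. Qed.

Lemma minf_delta_subproof p q (x : R) : exists n, forall i j,
  (n <= i)%N || (n <= j)%N -> (if (i == p) && (j == q) then x else 0) = 0.
Proof.
exists (maxn p q).+1 => i j; rewrite !gtn_max.
by case: eqP => [->|//]; case: eqP => [->|//]; rewrite !ltnn !andbF.
Qed.
Definition minf_delta p q (x : R) : Minf R := MkMinf (minf_delta_subproof p q x).

Lemma minf_deltaE p q x i j :
  minf_delta p q x i j = if (i == p) && (j == q) then x else 0.
Proof. by []. Qed.

Lemma minf_mul_deltal p q x a i j :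
  minf_mul (minf_delta p q x) a i j = if i == p then x * a q j else 0.
Proof.
rewrite (@minf_mulE _ _ _ q.+1) => [|k]; last first.
  by rewrite minf_deltaE; case: (k =P q) => [->|]; rewrite ?ltnn ?andbF ?mul0r.
rewrite big_ord_recr /= !eqxx andbT big1 ?add0r => [|k _]; last first.
  by rewrite (ltn_eqF (ltn_ord k)) andbF mul0r.
by case: eqP; rewrite ?mul0r.
Qed.

Lemma minf_mul_deltar p q x a i j :
  minf_mul a (minf_delta p q x) i j = if j == q then a i p * x else 0.
Proof.
rewrite (@minf_mulE _ _ _ p.+1) => [|k]; last first.
  by rewrite minf_deltaE; case: (k =P p) => [->|]; rewrite ?ltnn ?mulr0.
rewrite big_ord_recr /= eqxx /= big1 ?add0r => [|k _]; last first.
  by rewrite (ltn_eqF (ltn_ord k)) mulr0.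
by case: eqP; rewrite ?mulr0.
Qed.

Lemma minf_delta_mul p q r x y :
  minf_mul (minf_delta p q x) (minf_delta q r y) = minf_delta p r (x * y).
Proof.
apply: minf_ext => i j; rewrite minf_mul_deltal !minf_deltaE eqxx /=.
by case: eqP => //= _; case: eqP; rewrite ?mulr0.
Qed.

Lemma minf_delta_mul3 p q r s x y a :
  minf_mul (minf_mul (minf_delta p q x) a) (minf_delta r s y) =
  minf_delta p s (x * a q r * y).
Proof.
apply: minf_ext => i j; rewrite minf_mul_deltar minf_mul_deltal minf_deltaE.
by case: (i =P p); case: (j =P s); rewrite //= mul0r.
Qed.

(** An idempotent of the ring itself, seen as a 1 x 1 matrix. *)
Definition idem_elt (x : R) (xx : x * x = x) : Idem R :=
  @MkIdem R (minf_delta 0 0 x)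
    (etrans (minf_delta_mul 0 0 0 x x) (congr1 (minf_delta 0 0) xx)).

Lemma idem1E : idem1 R = idem_elt (mulr1 1).
Proof.
apply: idem_ext; apply: minf_ext => i j /=.
case: insubP => [i' lti _|]; last by case: i.
case: insubP => [j' ltj _|]; last by case: j => //= ?; rewrite andbF.
by case: i lti => // _; case: j ltj => // _; rewrite !ord1 mxE.
Qed.

Lemma idem0E (x : R) (xx : x * x = x) : x = 0 -> idem_elt xx = idem0 R.
Proof.
move=> x0; apply: idem_ext; apply: minf_ext => i j.
by rewrite minf_deltaE minf0E x0 if_same.
Qed.

Lemma Vclass_equiv (x y u v : R) (xx : x * x = x) (yy : y * y = y) :
  x = u * v -> y = v * u -> Vclass (idem_elt xx) = Vclass (idem_elt yy).
Proof.
move=> xE yE; apply/VclassP; exists (minf_delta 0 0 u), (minf_delta 0 0 v).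
by rewrite !minf_delta_mul -xE -yE.
Qed.

Lemma Vclass_elt_compl (x y : R) (xx : x * x = x) (yy : y * y = y) :
  x * y = 0 -> y * x = 0 -> x + y = 1 ->
  Vclass (idem_elt xx) + Vclass (idem_elt yy) = V_unit R.
Proof.
have d0 : minf_delta 0 0 0 = minf0 R.
  by apply: minf_ext => i j; rewrite minf_deltaE minf0E if_same.
move=> xy yx xDy; rewrite /V_unit idem1E.
apply: V_add_orth; rewrite /= ?minf_delta_mul ?xy ?yx //.
apply: minf_ext => i j; rewrite minf_addE !minf_deltaE -xDy.
by case: ifP; rewrite // addr0.
Qed.

End MinfCalculus.

(** * Generation of V by the classes of given idempotents *)

Section Generation.
(** [I] plays the role of the Jacobson radical, and the [e i] that of the primitive idempotents:
    every element outside [I] can be multiplied on both sides into some [e i]. *)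
Variables (R : pzRingType) (T : Type) (e : T -> R) (I : R -> Prop).
Hypothesis ee : forall i, e i * e i = e i.
Hypothesis ID : forall x y, I x -> I y -> I (x + y).
Hypothesis IM : forall x y, I y -> I (x * y).
Hypothesis I_rad : forall x, I x -> exists y, y * (1 - x) = 1.
Hypothesis I_out : forall x, ~ I x -> exists i y z, y * x * z = e i.

(** Gaussian elimination for v = a v: since 1 - [a n n] has a left inverse [w], the last equation
    gives [v n] in terms of the other unknowns. Substituting it leaves a smaller system whose
    coefficients still lie in [I]. *)
Lemma nakayama n (a : nat -> nat -> R) (v : nat -> R) :
  (forall i j, I (a i j)) ->
  (forall i, (i < n)%N -> v i = \sum_(j < n) a i j * v j) ->
  forall i, (i < n)%N -> v i = 0.
Proof.
elim: n a => // n IH a Ia va.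
have [w wK] := I_rad (Ia n n).
have vn : v n = \sum_(j < n) w * a n j * v j.
  rewrite -[LHS]mul1r -wK -mulrA mulrBl mul1r {1}(va n (ltnSn n)).
  by rewrite big_ord_recr addrK mulr_sumr; apply: eq_bigr => j _; rewrite mulrA.
have v0 i : (i < n)%N -> v i = 0.
  apply: (IH (fun i j => a i j + a i n * (w * a n j))) => [j k|j jn].
    by apply: ID => //; rewrite mulrA; apply: IM.
  rewrite va ?(ltn_trans jn) // big_ord_recr /= {1}vn mulr_sumr -big_split.
  by apply: eq_bigr => k _; rewrite mulrDl !mulrA.
move=> i; rewrite ltnS leq_eqVlt => /predU1P[->|/v0 //].
by rewrite vn big1 // => j _; rewrite v0 ?mulr0.
Qed.

(** As a a = a, every column v of a satisfies v = a v, and [nakayama] applies to it. *)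
Lemma idem_rad_eq0 (a : Idem R) : (forall i j, I (a i j)) -> a = idem0 R.
Proof.
move=> Ia; have [N h] := minf_bounded a; apply: idem_ext.
apply: minf_ext => i k; rewrite minf0E; case: (ltnP i N) => [iN|Ni].
  apply: (nakayama (v := fun i => a i k) Ia _ iN) => j jN.
  rewrite -{1}(idemP a) (@minf_mulE _ _ _ N) // => l Nl.
  by rewrite h ?Nl ?orbT ?mul0r.
by rewrite h ?Ni.
Qed.

(** Some entry of a lies outside [I], hence y a_kl z = e i for some y, z. This yields a column X and
    a row Y with a X = X, Y a = Y and Y X = e i. Then b = X Y is an idempotent below a and
    equivalent to e i, and a - b is the complement. *)
Lemma V_split (a : Idem R) : a <> idem0 R ->
  exists i (c : Idem R), Vclass a = Vclass (idem_elt (ee i)) + Vclass c.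
Proof.
move=> a0; have [k [l akl]] : exists k l, ~ I (a k l).
  apply: contrapT => nI; apply: a0; apply: idem_rad_eq0 => k l.
  by apply: contrapT => nIkl; apply: nI; exists k, l.
have [i [y [z yz]]] := I_out akl.
pose X := minf_mul a (minf_delta l 0 (z * e i)).
pose Y := minf_mul (minf_delta 0 k (e i * y)) a.
have aX : minf_mul a X = X by rewrite minf_mulA idemP.
have Ya : minf_mul Y a = Y by rewrite -minf_mulA idemP.
have YX : minf_mul Y X = minf_delta 0 0 (e i).
  rewrite minf_mulA -/Y Ya minf_delta_mul3; congr minf_delta.
  by rewrite mulrA -!(mulrA (e i)) yz !ee.
have Xe : minf_mul X (minf_delta 0 0 (e i)) = X.
  by rewrite -minf_mulA minf_delta_mul -mulrA ee.
pose b := minf_mul X Y.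
have ab : minf_mul a b = b by rewrite minf_mulA aX.
have ba : minf_mul b a = b by rewrite -minf_mulA Ya.
have bb : minf_idem b.
  by rewrite /minf_idem minf_mulA -(minf_mulA X) YX Xe.
have cc : minf_idem (minf_sub a b).
  by rewrite /minf_idem minf_mulBl !minf_mulBr idemP ab ba bb minf_subrr minf_subr0.
exists i, (MkIdem cc).
have -> : Vclass (idem_elt (ee i)) = Vclass (MkIdem bb).
  by apply/VclassP/idem_equiv_sym; exists X, Y.
apply/esym/V_add_orth => /=.
- by rewrite minf_mulBr ba bb minf_subrr.
- by rewrite minf_mulBl ab bb minf_subrr.
- by rewrite minf_subKC.
Qed.

(** Splitting off generators terminates because the additive measure [eta] is positive on each of
    them. *)
Lemma V_ind (eta : V R -> nat) (P : V R -> Prop) :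
  {morph eta : u w / u + w >-> (u + w)%N} ->
  (forall i, 0 < eta (Vclass (idem_elt (ee i))))%N -> P 0 ->
  (forall i u, P u -> P (Vclass (idem_elt (ee i)) + u)) -> forall u, P u.
Proof.
move=> etaD eta_e P0 PD u; elim/ltn_ind: {u}(eta u) {-2}u (erefl (eta u)) => n IH u nE.
rewrite -(VclassK u); have [->//|/V_split[i [c uE]]] := pselect (repr u = idem0 R).
rewrite uE; apply: PD; apply: (IH (eta (Vclass c))) => //.
by rewrite -nE -[in X in (_ < X)%N](VclassK u) uE etaD -[X in (X < _)%N]add0n ltn_add2r.
Qed.

End Generation.

(** * Ranks *)

Section Rank.
Variable F : fieldType.
Implicit Types a b c : Minf F.

Definition bounded_by n a :=
  forall i j, (n <= i)%N || (n <= j)%N -> a i j = 0.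

Definition trunc n a : 'M[F]_n := \matrix_(i, j) a i j.

Lemma bounded_by_leq m n a : (m <= n)%N -> bounded_by m a -> bounded_by n a.
Proof.
move=> mn am i j /orP[]ni; apply: am; apply/orP;
  [left|right]; exact: leq_trans ni.
Qed.

Lemma trunc_add n a b : trunc n (minf_add a b) = trunc n a + trunc n b.
Proof. by apply/matrixP => i j; rewrite !mxE minf_addE. Qed.

Lemma trunc_mul n a b : bounded_by n a ->
  trunc n (minf_mul a b) = trunc n a *m trunc n b.
Proof.
move=> an; apply/matrixP => i j; rewrite !mxE (@minf_mulE _ _ _ n).
  by apply: eq_bigr => k _; rewrite !mxE.
by move=> k nk; rewrite an ?nk ?orbT ?mul0r.
Qed.

(** When size n contains the whole support of a, any truncation is obtained from that of size n by
    multiplying with the rectangular identity matrices [L] and [U]. Used in both directions, this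
    makes the rank independent of the bound. *)
Lemma rank_trunc_le m n a : bounded_by n a ->
  (\rank (trunc m a) <= \rank (trunc n a))%N.
Proof.
move=> an; pose L : 'M[F]_(m, n) := \matrix_(i, j) (i == j :> nat)%:R.
pose U : 'M[F]_(n, m) := \matrix_(i, j) (i == j :> nat)%:R.
suff -> : trunc m a = L *m trunc n a *m U.
  by rewrite (leq_trans (mxrankM_maxl _ _)) ?mxrankM_maxr.
apply/matrixP => i j; rewrite !mxE.
have Lrow k : (L *m trunc n a) i k = a i k.
  rewrite mxE; case: (ltnP i n) => [lti|nlei].
    rewrite (bigD1 (Ordinal lti)) //= big1 => [|l /eqP li].
      by rewrite !mxE eqxx mul1r addr0.
    rewrite !mxE; case: eqP => [il|]; last by rewrite mul0r.
    by case: li; apply: val_inj.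
  rewrite an ?nlei // big1 // => l _; rewrite !mxE gtn_eqF ?mul0r //.
  exact: leq_trans nlei.
under eq_bigr do rewrite Lrow; case: (ltnP j n) => [ltj|nlej].
  rewrite (bigD1 (Ordinal ltj)) //= big1 => [|l /eqP lj].
    by rewrite !mxE eqxx mulr1 addr0.
  rewrite !mxE; case: eqP => [jl|]; last by rewrite mulr0.
  by case: lj; apply: val_inj.
rewrite an ?nlej ?orbT // big1 // => l _; rewrite !mxE ltn_eqF ?mulr0 //.
exact: leq_trans nlej.
Qed.

(** The bound is an arbitrary chosen one; [minf_rankE] allows any other. *)
Definition minf_rank a : nat :=
  \rank (trunc (projT1 (cid (minf_bounded a))) a).

Lemma minf_rankE n a : bounded_by n a -> minf_rank a = \rank (trunc n a).
Proof.
rewrite /minf_rank; case: cid => m am an /=.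
by apply/eqP; rewrite eqn_leq !rank_trunc_le.
Qed.

Lemma bounded_by_common a b c :
  exists n, [/\ bounded_by n a, bounded_by n b & bounded_by n c].
Proof. by have [n h] := minf_bound3 a b c; exists n; split=> i j /h[]. Qed.

(** If a = x y and b = y x, then a = a a = x b y, and a product has at most the rank of its factor
    b. *)
Lemma minf_rank_equiv_le (a b : Idem F) :
  idem_equiv a b -> (minf_rank a <= minf_rank b)%N.
Proof.
case=> x [y [aE bE]].
have [n0 [xn0 yn0 _]] := bounded_by_common x y y.
have [m [am bm _]] := bounded_by_common a b b.
pose n := maxn n0 m.
have [xn yn] : bounded_by n x /\ bounded_by n y.
  by split; apply: bounded_by_leq (leq_maxl _ _) _.
have [an bn] : bounded_by n a /\ bounded_by n b.
  by split; apply: bounded_by_leq (leq_maxr _ _) _.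
rewrite (minf_rankE an) (minf_rankE bn).
have -> : trunc n a = trunc n x *m trunc n b *m trunc n y.
  by rewrite -mulmxA -!trunc_mul // bE !minf_mulA -aE -minf_mulA -aE idemP.
by rewrite (leq_trans (mxrankM_maxl _ _)) ?mxrankM_maxr.
Qed.

Lemma minf_rank_equiv (a b : Idem F) :
  idem_equiv a b -> minf_rank a = minf_rank b.
Proof.
move=> ab; apply/eqP; rewrite eqn_leq.
by rewrite !minf_rank_equiv_le //; apply: idem_equiv_sym.
Qed.

(** The row spaces of A and B meet in 0: a matrix X = Y A = Z B satisfies X = X B = Y A B = 0. Both
    lie in the row space of A + B, as A (A + B) = A and B (A + B) = B. *)
Lemma mxrank_add_orth n (A B : 'M[F]_n) : A *m A = A -> B *m B = B ->
  A *m B = 0 -> B *m A = 0 -> \rank (A + B)%R = (\rank A + \rank B)%N.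
Proof.
move=> AA BB AB BA; apply/eqP; rewrite eqn_leq mxrank_add /=.
rewrite -mxrank_disjoint_sum; last first.
  apply/eqP; rewrite -submx0; set X := (A :&: B)%MS.
  have /submxP[Y XA] : (X <= A)%MS by rewrite capmxSl.
  have /submxP[Z XB] : (X <= B)%MS by rewrite capmxSr.
  have XX : X = X *m B by rewrite {2}XB -mulmxA BB -XB.
  by rewrite XX XA -mulmxA AB mulmx0.
apply: mxrankS; rewrite addsmx_sub; apply/andP; split; apply/submxP.
  by exists A; rewrite mulmxDr AA AB addr0.
by exists B; rewrite mulmxDr BB BA add0r.
Qed.

Definition V_rank (u : V F) : nat := minf_rank (repr u).

Lemma V_rank_class (a : Idem F) : V_rank (Vclass a) = minf_rank a.
Proof. by apply: minf_rank_equiv; apply/VclassP; rewrite VclassK. Qed.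

Lemma V_rank_nmod_morphism : nmod_morphism V_rank.
Proof.
split=> [|u w].
  by rewrite [V_rank _]V_rank_class (@minf_rankE 0) ?thinmx0 ?mxrank0 // => i j _;
    rewrite minf0E.
have [a [b [c [[<- <- ->] [ab ba cE]]]]] := V_orth_decomp u w.
have [n [an bn cn]] := bounded_by_common a b c.
rewrite !V_rank_class (minf_rankE an) (minf_rankE bn) (minf_rankE cn) cE trunc_add.
have trunc0 : trunc n (minf0 F) = 0.
  by apply/matrixP => i j; rewrite !mxE minf0E.
by apply: mxrank_add_orth; rewrite -trunc_mul ?idemP ?ab ?ba.
Qed.

HB.instance Definition _ :=
  GRing.isNmodMorphism.Build (V F) nat V_rank V_rank_nmod_morphism.

Lemma V_rank_unit : V_rank (V_unit F) = 1%N.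
Proof.
rewrite [V_unit F]/V_unit idem1E V_rank_class (@minf_rankE 1) => [|i j].
  suff -> : trunc 1 (idem_elt (mulr1 1)) = 1%:M by rewrite mxrank1.
  by apply/matrixP => i j; rewrite !ord1 !mxE.
by case: i j => [|i] [|j].
Qed.

End Rank.

(** * From matrices over M_2(R) to matrices over R *)

Section Flatten.
Variable R : pzRingType.
Implicit Types a b : Minf 'M[R]_2.

Definition parity i : 'I_2 := inord (odd i).

Lemma minf_flat_subproof a : exists n, forall i j,
  (n <= i)%N || (n <= j)%N -> a i./2 j./2 (parity i) (parity j) = 0.
Proof.
have [n an] := minf_bounded a; exists n.*2 => i j; rewrite -!geq_half_double.
by move=> /an ->; rewrite mxE.
Qed.
(** Erases the borders of the 2 x 2 blocks: index i is row or column [parity i] of block [i./2]. On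
    V this gives the Morita map from V(M_2(R)) to V(R). *)
Definition minf_flat a : Minf R := MkMinf (minf_flat_subproof a).

Lemma minf_flatE a i j : minf_flat a i j = a i./2 j./2 (parity i) (parity j).
Proof. by []. Qed.

Lemma minf_flat_mul a b :
  minf_flat (minf_mul a b) = minf_mul (minf_flat a) (minf_flat b).
Proof.
have [n an] := minf_bounded a; apply: minf_ext => i k.
rewrite (@minf_mulE _ _ _ n.*2) => [|j]; last first.
  by rewrite -geq_half_double => nj; rewrite minf_flatE an ?nj ?orbT // mxE mul0r.
rewrite (sum_double (fun j => minf_flat a i j * minf_flat b j k)) minf_flatE.
rewrite (@minf_mulE _ _ _ n) => [|j nj]; last first.
  by rewrite an ?nj ?orbT // mul0r.
rewrite summxE; apply: eq_bigr => j _.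
rewrite mxE big_ord_recl big_ord1 !minf_flatE /=.
rewrite /parity !(doubleK, odd_double, uphalf_double) /=.
by congr (_ * _ + _ * _); congr (fun_of_matrix _ _ _); apply: val_inj;
  rewrite /= ?inordK ?odd_double.
Qed.

Lemma idem_flat_subproof (a : Idem 'M[R]_2) : minf_idem (minf_flat a).
Proof. by rewrite /minf_idem -minf_flat_mul idemP. Qed.
Definition idem_flat (a : Idem 'M[R]_2) : Idem R := MkIdem (idem_flat_subproof a).

Definition Vflat (u : V 'M[R]_2) : V R := Vclass (idem_flat (repr u)).

Lemma Vflat_class (a : Idem 'M[R]_2) : Vflat (Vclass a) = Vclass (idem_flat a).
Proof.
have /VclassP[x [y [aE aE']]] := VclassK (Vclass a).
apply/VclassP; exists (minf_flat x), (minf_flat y).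
by rewrite -!minf_flat_mul -aE -aE'.
Qed.

Lemma Vflat_nmod_morphism : nmod_morphism Vflat.
Proof.
have flat0 : minf_flat (minf0 _) = minf0 _.
  by apply: minf_ext => i j; rewrite minf_flatE !minf0E mxE.
split=> [|u w].
  by rewrite [Vflat _]Vflat_class; congr Vclass; apply: idem_ext.
have [a [b [c [[<- <- ->] [ab ba cE]]]]] := V_orth_decomp u w.
rewrite !Vflat_class; apply/esym/V_add_orth.
- by rewrite -minf_flat_mul ab.
- by rewrite -minf_flat_mul ba.
- by apply: minf_ext => i j; rewrite minf_flatE [LHS]/= cE minf_addE mxE.
Qed.

HB.instance Definition _ :=
  GRing.isNmodMorphism.Build (V 'M[R]_2) (V R) Vflat Vflat_nmod_morphism.

End Flatten.

(** * Rational functions and their residues at 0 *)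

Section FractionLift.
Variables (R : idomainType) (L : fieldType) (f : {rmorphism R -> L}).
Hypothesis f_inj : injective f.

Import FracField.

(** Relates the quotient construction of fractions by pairs to division in the resulting field; the
    equation is checked after multiplication by the denominator. *)
Lemma fraction_repr (x : {fraction R}) :
  x = (\n_(repr x))%:F / (\d_(repr x))%:F.
Proof.
set r := repr x; have -> : x = (\pi_{fraction R} r)%qT by rewrite reprK.
have d0 : (\d_r)%:F != 0 :> {fraction R} by rewrite tofrac_eq0 denom_ratioP.
apply: (mulIf d0); rewrite divfK //.
rewrite !piE; apply/eqmodP; rewrite /= equivfE /mulf.
by rewrite !numden_Ratio ?mulf_neq0 ?oner_neq0 ?denom_ratioP // mulr1 mulr1 mulrC.
Qed.

Lemma fraction_numden (x : {fraction R}) :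
  exists n d, d != 0 /\ x = n%:F / d%:F.
Proof.
by exists (\n_(repr x)), (\d_(repr x)); rewrite denom_ratioP -fraction_repr.
Qed.

Lemma fraction_eq (n d n' d' : R) : d != 0 -> d' != 0 ->
  (n%:F / d%:F == n'%:F / d'%:F) = (n * d' == n' * d).
Proof.
by move=> d0 d0'; rewrite eqr_div ?tofrac_eq0 // -!rmorphM tofrac_eq.
Qed.

(** Defined on the chosen representative of x; by [fraction_liftE] every other one gives the same
    value, since nonzero denominators stay nonzero under the injective [f]. *)
Definition fraction_lift (x : {fraction R}) : L :=
  f \n_(repr x) / f \d_(repr x).

Lemma fraction_liftE n d : d != 0 -> fraction_lift (n%:F / d%:F) = f n / f d.
Proof.
move=> d0; rewrite /fraction_lift; set r := repr _.
have f0 x : x != 0 -> f x != 0 by move=> x0; rewrite -(rmorph0 f) inj_eq.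
have /eqP := fraction_repr (n%:F / d%:F); rewrite -/r fraction_eq ?denom_ratioP //.
move=> /eqP nd; apply/eqP.
by rewrite eqr_div ?f0 ?denom_ratioP // -!rmorphM nd.
Qed.

Lemma fraction_lift_tofrac n : fraction_lift n%:F = f n.
Proof.
by rewrite -[n%:F]divr1 -(tofrac1 _) fraction_liftE ?oner_neq0 // rmorph1 divr1.
Qed.

Lemma fraction_lift_zmod_morphism : zmod_morphism fraction_lift.
Proof.
move=> x y; have [n [d [d0 ->]]] := fraction_numden x.
have [m [c [c0 ->]]] := fraction_numden y.
have f0 z : z != 0 -> f z != 0 by move=> z0; rewrite -(rmorph0 f) inj_eq.
rewrite -mulNr -rmorphN addf_div ?tofrac_eq0 // -!rmorphM -rmorphD.
rewrite !fraction_liftE ?mulf_neq0 // rmorphD !rmorphM rmorphN -mulNr.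
by rewrite addf_div ?f0.
Qed.

Lemma fraction_lift_monoid_morphism : monoid_morphism fraction_lift.
Proof.
split=> [|x y]; first by rewrite -(tofrac1 _) fraction_lift_tofrac rmorph1.
have [n [d [d0 ->]]] := fraction_numden x.
have [m [c [c0 ->]]] := fraction_numden y.
by rewrite mulf_div -!rmorphM !fraction_liftE ?mulf_neq0 // !rmorphM mulf_div.
Qed.

End FractionLift.

(** * The automorphism t |-> 1 - t of K(t), and values at t = 0 *)

Section RationalFunctions.
Variable K : fieldType.

Local Notation F := {fraction {poly K}}.

Definition reflect_poly (p : {poly K}) : F := (p \Po (1 - 'X))%:F.

Lemma reflect_poly_rmorphism :
  zmod_morphism reflect_poly * monoid_morphism reflect_poly.
Proof.
split=> [p q|]; first by rewrite /reflect_poly !rmorphB.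
by split=> [|p q]; rewrite /reflect_poly ?rmorph1 ?rmorphM.
Qed.

HB.instance Definition _ := GRing.isZmodMorphism.Build _ _ reflect_poly
  (fst reflect_poly_rmorphism).
HB.instance Definition _ := GRing.isMonoidMorphism.Build _ _ reflect_poly
  (snd reflect_poly_rmorphism).

Lemma comp_poly_reflectK (p : {poly K}) : (p \Po (1 - 'X)) \Po (1 - 'X) = p.
Proof.
rewrite -comp_polyA !(rmorphB, rmorph1) /= comp_polyX opprB addrC subrK.
by rewrite comp_polyXr.
Qed.

Lemma reflect_poly_inj : injective reflect_poly.
Proof.
move=> p q /eqP; rewrite tofrac_eq => /eqP pq.
by rewrite -[p]comp_poly_reflectK pq comp_poly_reflectK.
Qed.

Definition ratfun_reflect : F -> F := fraction_lift reflect_poly.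

HB.instance Definition _ := GRing.isZmodMorphism.Build _ _ ratfun_reflect
  (fraction_lift_zmod_morphism reflect_poly_inj).
HB.instance Definition _ := GRing.isMonoidMorphism.Build _ _ ratfun_reflect
  (fraction_lift_monoid_morphism reflect_poly_inj).

Lemma ratfun_reflectE p : ratfun_reflect p%:F = (p \Po (1 - 'X))%:F.
Proof. exact: (fraction_lift_tofrac reflect_poly_inj). Qed.

Lemma ratfun_reflectK : involutive ratfun_reflect.
Proof.
move=> x; rewrite [ratfun_reflect x]/fraction_lift fmorph_div /= !ratfun_reflectE.
by rewrite !comp_poly_reflectK -fraction_repr.
Qed.

(** x is regular at t = 0 with value k, that is, k is its class in the residue field of the local
    ring at 0. As a relation it expresses regularity and the value at once. *)
Definition residue (x : F) (k : K) : Prop :=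
  exists n d : {poly K}, [/\ d.[0] != 0, x = n%:F / d%:F & k = n.[0] / d.[0]].

Lemma horner_neq0 (d : {poly K}) : d.[0] != 0 -> d != 0.
Proof. by apply: contraNneq => ->; rewrite horner0. Qed.

Lemma residue_fun x k l : residue x k -> residue x l -> k = l.
Proof.
move=> [n [d [d0 -> ->]]] [m [c [c0 /eqP + ->]]].
rewrite fraction_eq ?horner_neq0 // => /eqP nc.
by apply/eqP; rewrite eqr_div // -!hornerM nc.
Qed.

Lemma residueB x y k l : residue x k -> residue y l -> residue (x - y) (k - l).
Proof.
move=> [n [d [d0 -> ->]]] [m [c [c0 -> ->]]].
exists (n * c - m * d), (d * c); split; first by rewrite hornerM mulf_neq0.
  rewrite -mulNr addf_div ?tofrac_eq0 ?horner_neq0 //.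
  by rewrite rmorphB !rmorphM mulNr.
by rewrite -mulNr addf_div // hornerD hornerN !hornerM mulNr.
Qed.

Lemma residueM x y k l : residue x k -> residue y l -> residue (x * y) (k * l).
Proof.
move=> [n [d [d0 -> ->]]] [m [c [c0 -> ->]]].
exists (n * m), (d * c); split; first by rewrite hornerM mulf_neq0.
  by rewrite mulf_div !rmorphM.
by rewrite mulf_div !hornerM.
Qed.

Lemma residueV x k : k != 0 -> residue x k -> residue x^-1 k^-1.
Proof.
move=> k0 [n [d [d0 -> kE]]]; have n0 : n.[0] != 0.
  by apply: contraNneq k0; rewrite kE => ->; rewrite mul0r.
rewrite kE.
by exists d, n; rewrite !invf_div.
Qed.

Lemma residue_poly p : residue p%:F p.[0].
Proof. by exists p, 1; rewrite hornerC oner_neq0 rmorph1 !divr1. Qed.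

Lemma residue0 : residue 0 0.
Proof. by rewrite -(tofrac0 _) -[X in residue _ X](horner0 0); apply: residue_poly. Qed.

Lemma residue1 : residue 1 1.
Proof. by rewrite -(tofrac1 _) -[X in residue _ X](hornerC 1 0); apply: residue_poly. Qed.

Lemma residueD x y k l : residue x k -> residue y l -> residue (x + y) (k + l).
Proof.
move=> xk yl; rewrite -[y]opprK -[l]opprK -[- y]sub0r -[- l]sub0r.
by apply: residueB xk _; apply: residueB yl; apply: residue0.
Qed.

(** Functions with a pole at 0 get the default value 0. *)
Definition res (x : F) : K :=
  if pselect (exists k, residue x k) is left h then projT1 (cid h) else 0.

Lemma resE x k : residue x k -> res x = k.
Proof.
move=> xk; rewrite /res; case: pselect => [h|[]]; last by exists k.
by case: cid => l /= /residue_fun; apply.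
Qed.

End RationalFunctions.

(** * Morphisms on V and matrices of size 2 *)

Section Vmaps.

Lemma Vmap_comp (R S T : pzRingType) (f : {rmorphism R -> S})
    (g : {rmorphism S -> T}) (k : {rmorphism R -> T}) :
  (forall x, g (f x) = k x) -> forall u, Vmap g (Vmap f u) = Vmap k u.
Proof.
move=> gf u; rewrite -(VclassK u) !Vmap_class; congr Vclass.
by apply: idem_ext; apply: minf_ext => i j; rewrite !minf_mapE gf.
Qed.

Lemma Vmap_elt (R S : pzRingType) (f : {rmorphism R -> S}) x
    (xx : x * x = x) y (yy : y * y = y) :
  f x = y -> Vmap f (Vclass (idem_elt xx)) = Vclass (idem_elt yy).
Proof.
move=> fx; rewrite Vmap_class; congr Vclass; apply: idem_ext.
apply: minf_ext => i j; rewrite minf_mapE !minf_deltaE -fx.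
by case: ifP; rewrite ?rmorph0.
Qed.

Lemma V_rank_map1 (R : pzRingType) (F : fieldType) (f : {rmorphism R -> F}) x
    (xx : x * x = x) :
  f x = 1 -> V_rank (Vmap f (Vclass (idem_elt xx))) = 1%N.
Proof.
move=> fx; rewrite (Vmap_elt xx (mulr1 1) fx) -[RHS](V_rank_unit F).
by rewrite /V_unit idem1E.
Qed.

Lemma V_rank_map0 (R : pzRingType) (F : fieldType) (f : {rmorphism R -> F}) x
    (xx : x * x = x) :
  f x = 0 -> V_rank (Vmap f (Vclass (idem_elt xx))) = 0%N.
Proof.
by move=> fx; rewrite (Vmap_elt xx (mulr0 0) fx) idem0E // [LHS]raddf0.
Qed.

(** For a ring with two morphisms to a field, the ranks of both images. This becomes the isomorphism
    onto pairs of naturals for B and for C. *)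
Definition V_rank2 (R : pzRingType) (F : fieldType) (f g : {rmorphism R -> F})
  (u : V R) : nat * nat := (V_rank (Vmap f u), V_rank (Vmap g u)).

Lemma V_rank2_nmod_morphism (R : pzRingType) (F : fieldType)
    (f g : {rmorphism R -> F}) :
  nmod_morphism (V_rank2 f g).
Proof. by split=> [|u w]; rewrite /V_rank2 ?raddf0 ?raddfD. Qed.

HB.instance Definition _ (R : pzRingType) (F : fieldType) (f g : {rmorphism R -> F}) :=
  GRing.isNmodMorphism.Build (V R) (nat * nat)%type (V_rank2 f g)
    (V_rank2_nmod_morphism f g).

Lemma Vmap_id (R : pzRingType) (f : {rmorphism R -> R}) :
  (forall x, f x = x) -> forall u, Vmap f u = u.
Proof.
move=> fid u; rewrite -(VclassK u) Vmap_class; congr Vclass.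
by apply: idem_ext; apply: minf_ext => i j; rewrite minf_mapE fid.
Qed.

Lemma V_rank2_map (R S : pzRingType) (F : fieldType) (f : {rmorphism R -> S})
    (phi psi : {rmorphism S -> F}) (phi' psi' : {rmorphism R -> F}) :
  (forall x, phi (f x) = phi' x) -> (forall x, psi (f x) = psi' x) ->
  forall u, V_rank2 phi psi (Vmap f u) = V_rank2 phi' psi' u.
Proof.
by move=> phif psif u; rewrite /V_rank2 (Vmap_comp phif) (Vmap_comp psif).
Qed.

(** The induction principle says that x generates M, so n |-> n x is inverse to [eta]. *)
Lemma bijective_nat (M : nmodType) (eta : {additive M -> nat}) (x : M) :
  eta x = 1%N ->
  (forall P : M -> Prop, P 0 -> (forall u, P u -> P (x + u)) -> forall u, P u) ->
  bijective eta.
Proof.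
move=> etax ind; exists (fun n => x *+ n) => [|n].
  elim/ind => [|u IH]; first by rewrite raddf0.
  by rewrite raddfD etax -[(_ + _)%R]/(_ + _)%N mulrS IH.
by rewrite raddfMn etax; elim: n => // n IH; rewrite mulrS IH.
Qed.

Lemma bijective_nat2 (M : nmodType) (eta : {additive M -> (nat * nat)%type})
    (x : bool -> M) :
  eta (x true) = (1, 0)%N -> eta (x false) = (0, 1)%N ->
  (forall P : M -> Prop, P 0 -> (forall b u, P u -> P (x b + u)) ->
     forall u, P u) ->
  bijective eta.
Proof.
move=> eta1 eta2 ind.
exists (fun p => x true *+ p.1 + x false *+ p.2) => [|[m n]].
  elim/ind => [|b u IH]; first by rewrite raddf0 addr0.
  rewrite -[in RHS]IH raddfD; case: b; rewrite ?eta1 ?eta2.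
    by rewrite -[LHS]/(x true *+ (eta u).1.+1 + _) mulrS addrA.
  by rewrite -[LHS]/(_ + x false *+ (eta u).2.+1) mulrS addrCA.
have mulE p k : (p : nat * nat) *+ k = (p.1 * k, p.2 * k)%N.
  elim: k => [|k IH]; first by rewrite !muln0.
  by rewrite mulrS IH !mulnS; case: p {IH}.
by rewrite raddfD !raddfMn eta1 eta2 !mulE /= !mul1n !mul0n; congr pair;
  rewrite /= ?[LHS]addn0.
Qed.

End Vmaps.

(* With p lifting a decomposition of x, the exchange idempotent is the conjugate
   of p by u = p x + (1 - p) (1 - x): p u = p x and (1 - p) u = (1 - p) (1 - x). *)
Lemma exchange_at (R : pzRingType) (x p w : R) : p * p = p ->
  w * (p * x + (1 - p) * (1 - x)) = 1 -> (p * x + (1 - p) * (1 - x)) * w = 1 ->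
  exists e r s : R, [/\ e * e = e, e = r * x & e = x + s - s * x].
Proof.
set u := _ + _ => pp wu uw.
have pq : p * (1 - p) = 0 by rewrite mulrBr mulr1 pp subrr.
have pu : p * u = p * x by rewrite mulrDr !mulrA pq pp mul0r addr0.
have qu : (1 - p) * u = (1 - p) * (1 - x).
  by rewrite mulrBl mul1r pu /u addrC addrA addNr add0r.
have eE : w * p * x = 1 - w * (1 - p) * (1 - x).
  by rewrite -mulrA -pu -mulrA -qu -{1}wu -mulrBr mulrBl mul1r subKr.
exists (w * p * x), (w * p), (1 - w * (1 - p)); split=> //.
  by rewrite -(mulrA w p x) -pu !mulrA -(mulrA (w * p) u w) uw mulr1 -(mulrA w p p) pp.
set W := w * (1 - p); rewrite eE -/W -addrA -{1}[1 - W]mulr1 -mulrBr mulrBl mul1r.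
by rewrite addrA [x + _]addrCA subrr addr0.
Qed.

(** * Matrices of size 2 in explicit entries *)

Section Matrix2.

Lemma ord2P (i : 'I_2) : i = 0 \/ i = 1.
Proof. by case: i => [[|[|]]] //= lti; [left|right]; apply: val_inj. Qed.

Lemma mx2P (T : Type) (A B : 'M[T]_2) : A 0 0 = B 0 0 -> A 0 1 = B 0 1 ->
  A 1 0 = B 1 0 -> A 1 1 = B 1 1 -> A = B.
Proof.
move=> h00 h01 h10 h11; apply/matrixP => i j.
by case: (ord2P i) => ->; case: (ord2P j) => ->.
Qed.

Definition mx2 (T : Type) (a b c d : T) : 'M[T]_2 :=
  \matrix_(i, j) if i == 0 then if j == 0 then a else b
                 else if j == 0 then c else d.

Lemma mx2E (T : Type) (a b c d : T) :
  ((mx2 a b c d 0 0 = a) * (mx2 a b c d 0 1 = b)) *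
  ((mx2 a b c d 1 0 = c) * (mx2 a b c d 1 1 = d)).
Proof. by rewrite !mxE. Qed.

Lemma mulmx2E (R : pzSemiRingType) (A B : 'M[R]_2) i j :
  (A * B) i j = A i 0 * B 0 j + A i 1 * B 1 j.
Proof.
rewrite [LHS]mxE big_ord_recl big_ord1; congr (_ + A i _ * B _ j);
  exact: val_inj.
Qed.

Lemma mx2_1E (R : pzRingType) :
  (((1 : 'M[R]_2) 0 0 = 1) * ((1 : 'M[R]_2) 0 1 = 0)) *
  (((1 : 'M[R]_2) 1 0 = 0) * ((1 : 'M[R]_2) 1 1 = 1)).
Proof. by rewrite !mxE. Qed.

Variable F : fieldType.
Implicit Types A : 'M[F]_2.

Definition det2 A := A 0 0 * A 1 1 - A 0 1 * A 1 0.

(** The adjugate divided by the determinant. The explicit entries make it possible to read off their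
    values at 0 in [local_unit]. *)
Definition inv2 A := mx2 (A 1 1 / det2 A) (- (A 0 1 / det2 A))
                         (- (A 1 0 / det2 A)) (A 0 0 / det2 A).

Lemma mulVmx2 A : det2 A != 0 -> inv2 A * A = 1.
Proof.
rewrite /inv2; set d := det2 A => d0.
by apply: mx2P; rewrite mulmx2E !mx2E mx2_1E /d /det2; field.
Qed.

Lemma mulmx2V A : det2 A != 0 -> A * inv2 A = 1.
Proof.
rewrite /inv2; set d := det2 A => d0.
by apply: mx2P; rewrite mulmx2E !mx2E mx2_1E /d /det2; field.
Qed.

(** If A or 1 - A is invertible, [exchange_at] applies with p = 1 or p = 0. Otherwise A turns out to
    be idempotent itself. *)
Lemma exchange_mx2 : exchange_ring 'M[F]_2.
Proof.
move=> A; have [dA|dA] := eqVneq (det2 A) 0; last first.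
  apply: (exchange_at (p := 1) (w := inv2 A)); rewrite ?mul1r //.
    by rewrite subrr mul0r addr0 mulVmx2.
  by rewrite subrr mul0r addr0 mulmx2V.
have [dB|dB] := eqVneq (det2 (1 - A)) 0; last first.
  apply: (exchange_at (p := 0) (w := inv2 (1 - A))); rewrite ?mul0r //.
    by rewrite subr0 mul1r add0r mulVmx2.
  by rewrite subr0 mul1r add0r mulmx2V.
(* As det A = 0 and 0 = det (1 - A) = 1 - tr A + det A, the trace is 1, and A A = A is the
   Cayley-Hamilton identity. *)
exists A, 1, 0; rewrite mul1r mul0r subr0 addr0; split=> //.
have trA : A 0 0 + A 1 1 = 1.
  apply/eqP; rewrite eq_sym -subr_eq0; apply/eqP.
  by rewrite -[RHS]subr0 -{1}dB -dA /det2 !mxE /=; ring.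
have bc : A 0 1 * A 1 0 = A 0 0 * A 1 1.
  by apply/esym/eqP; rewrite -subr_eq0 -/(det2 A) dA.
apply: mx2P; rewrite mulmx2E.
- by rewrite bc -mulrDr trA mulr1.
- by rewrite [A 0 0 * _]mulrC -mulrDr trA mulr1.
- by rewrite [A 1 1 * _]mulrC -mulrDr trA mulr1.
- by rewrite [A 1 0 * _]mulrC bc -mulrDl trA mul1r.
Qed.

End Matrix2.

(** * The algebras and their morphisms *)

(* The proof argument is there for the canonical morphism structures, which need it. *)
Definition idem_morph (K : fieldType) (A : algType K) (p : A) of p * p = p :=
  fun x : K^o * K^o => x.1 *: p + x.2 *: (1 - p).

Section IdempotentMorphism.
Variables (K : fieldType) (A : algType K) (p : A) (pp : p * p = p).

Lemma idem_morph_linear : linear (idem_morph pp).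
Proof.
move=> a x y; rewrite /idem_morph [a *: (_ + _)]scalerDr !scalerA.
by rewrite addrACA -!scalerDl.
Qed.

HB.instance Definition _ := GRing.isLinear.Build K (K^o * K^o)%type A _ (idem_morph pp)
  idem_morph_linear.

Lemma idem_morph_monoid_morphism : monoid_morphism (idem_morph pp).
Proof.
have pq : p * (1 - p) = 0 by rewrite mulrBr mulr1 pp subrr.
have qp : (1 - p) * p = 0 by rewrite mulrBl mul1r pp subrr.
have qq : (1 - p) * (1 - p) = 1 - p by rewrite mulrBl mul1r pq subr0.
split=> [|x y]; first by rewrite /idem_morph !scale1r addrC subrK.
rewrite /idem_morph mulrDl !mulrDr -!scalerAl -!scalerAr pp pq qp qq.
by rewrite !scaler0 addr0 add0r !scalerA.
Qed.

HB.instance Definition _ := GRing.isMonoidMorphism.Build (K^o * K^o)%type A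
  (idem_morph pp)
  idem_morph_monoid_morphism.
Definition idem_lrmorphism : {lrmorphism (K^o * K^o)%type -> A} := idem_morph pp.
End IdempotentMorphism.

Section Swap.
Variable K : fieldType.

Definition swap (x : K^o * K^o) : K^o * K^o := (x.2, x.1).

Definition diag (a : K^o) : K^o * K^o := (a, a).

Lemma diag_linear : linear diag. Proof. by []. Qed.
Lemma diag_monoid_morphism : monoid_morphism diag. Proof. by []. Qed.

HB.instance Definition _ :=
  GRing.isLinear.Build K K^o (K^o * K^o)%type _ diag diag_linear.
HB.instance Definition _ := GRing.isMonoidMorphism.Build _ _ diag
  diag_monoid_morphism.

Lemma swap_linear : linear swap. Proof. by []. Qed.
Lemma swap_monoid_morphism : monoid_morphism swap. Proof. by []. Qed.

HB.instance Definition _ :=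
  GRing.isLinear.Build K (K^o * K^o)%type (K^o * K^o)%type _ swap swap_linear.
HB.instance Definition _ := GRing.isMonoidMorphism.Build _ _ swap swap_monoid_morphism.
End Swap.

(** * The algebras D and C, and the idempotents P and Q *)

Section Algebras.
Variable K : fieldType.

Local Notation F := {fraction {poly K}}.

(** A separate name for the matrix ring, on which the scalars are the constants from K instead of
    all of K(t). *)
Definition ratmx : Type := 'M[F]_2.

HB.instance Definition _ := GRing.NzRing.on ratmx.

Definition ratmx_scale (k : K) (A : ratmx) : ratmx := (k%:P)%:F *: (A : 'M[F]_2).

Lemma ratmx_scaleA a b A : ratmx_scale a (ratmx_scale b A) = ratmx_scale (a * b) A.
Proof. by rewrite /ratmx_scale scalerA -tofracM -polyCM. Qed.

Lemma ratmx_scale1 : left_id 1 ratmx_scale.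
Proof. by move=> A; rewrite /ratmx_scale tofrac1 scale1r. Qed.

Lemma ratmx_scaleDr : right_distributive ratmx_scale +%R.
Proof. by move=> a A B; rewrite /ratmx_scale scalerDr. Qed.

Lemma ratmx_scaleDl A : {morph ratmx_scale^~ A : a b / a + b}.
Proof. by move=> a b; rewrite /ratmx_scale polyCD tofracD scalerDl. Qed.

HB.instance Definition _ := GRing.Zmodule_isLmodule.Build K ratmx
  ratmx_scaleA ratmx_scale1 ratmx_scaleDr ratmx_scaleDl.

Lemma ratmx_scaleAl (a : K) (A B : ratmx) : a *: (A * B) = (a *: A) * B.
Proof. exact: scalemxAl. Qed.

HB.instance Definition _ := GRing.Lmodule_isLalgebra.Build K ratmx ratmx_scaleAl.

Lemma ratmx_scaleAr (a : K) (A B : ratmx) : a *: (A * B) = A * (a *: B).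
Proof. exact: scalemxAr. Qed.

HB.instance Definition _ := GRing.Lalgebra_isAlgebra.Build K ratmx ratmx_scaleAr.

Lemma ratmx_scaleE (a : K) (A : ratmx) i j : (a *: A) i j = (a%:P)%:F * A i j.
Proof. by rewrite mxE. Qed.

(** The matrices that can be evaluated at t = 0 and become lower triangular there. *)
Definition local_mx : {pred ratmx} := fun A => `[< exists k l m,
  [/\ residue (A 0 0) k, residue (A 1 1) l, residue (A 1 0) m & residue (A 0 1) 0] >].

Lemma local_mxP (A : ratmx) : reflect (exists k l m,
  [/\ residue (A 0 0) k, residue (A 1 1) l, residue (A 1 0) m & residue (A 0 1) 0])
  (A \in local_mx).
Proof. exact: asboolP. Qed.

Lemma local_mx_subalg : subalg_closed local_mx.
Proof.
split.
- apply/local_mxP; exists 1, 1, 0; rewrite !mx2_1E.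
  by split; by [apply: residue1 | apply: residue0].
- move=> a A B /local_mxP[k [l [m [h00 h11 h10 h01]]]].
  move=> /local_mxP[k' [l' [m' [h00' h11' h10' h01']]]].
  have ra : residue (a%:P)%:F a by have := residue_poly a%:P; rewrite hornerC.
  apply/local_mxP; exists (a * k + k'), (a * l + l'), (a * m + m').
  have E i j : (a *: A + B) i j = (a%:P)%:F * A i j + B i j by rewrite !mxE.
  rewrite !E; split; try by apply: residueD => //; apply: residueM.
  by have := residueD (residueM ra h01) h01'; rewrite mulr0 addr0.
- move=> A B /local_mxP[k [l [m [h00 h11 h10 h01]]]].
  move=> /local_mxP[k' [l' [m' [h00' h11' h10' h01']]]].
  apply/local_mxP.
  (* The zero summands are kept so that the values have the shape of the entries of the product. *)
  exists (k * k' + 0 * m'), (m * 0 + l * l'), (m * k' + l * m').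
  rewrite !mulmx2E; split; try by apply: residueD; apply: residueM.
  have := residueD (residueM h00 h01') (residueM h01 h11').
  by rewrite mulr0 mul0r addr0.
Qed.

HB.instance Definition _ := GRing.isSubalgClosed.Build K ratmx local_mx local_mx_subalg.

Definition local_alg := {A : ratmx | A \in local_mx}.

HB.instance Definition _ := [isSub of local_alg for (@sval _ _)].
HB.instance Definition _ := [Choice of local_alg by <:].
HB.instance Definition _ := [SubChoice_isSubAlgebra of local_alg by <:].


Definition mk_local A (Al : A \in local_mx) : local_alg := exist _ A Al.

Definition local_incl : local_alg -> ratmx := val.
HB.instance Definition _ := GRing.RMorphism.on local_incl.
HB.instance Definition _ := GRing.Linear.on local_incl.

Definition diag_res (i : 'I_2) (A : local_alg) : K^o := res (local_incl A i i).

Lemma diag_residue i (A : local_alg) : residue (local_incl A i i) (diag_res i A).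
Proof.
have [k [l [m [h00 h11 _ _]]]] := local_mxP _ (valP A); rewrite /diag_res.
by case: (ord2P i) => ->; [rewrite (resE h00)|rewrite (resE h11)].
Qed.

Lemma diag_resE i (A : local_alg) k : residue (local_incl A i i) k -> diag_res i A = k.
Proof. exact: resE. Qed.

Lemma local_residue10 (A : local_alg) : exists m, residue (local_incl A 1 0) m.
Proof. by have [k [l [m []]]] := local_mxP _ (valP A); exists m. Qed.

Lemma local_residue01 (A : local_alg) : residue (local_incl A 0 1) 0.
Proof. by have [k [l [m []]]] := local_mxP _ (valP A). Qed.

Lemma diag_res_zmod_morphism i : zmod_morphism (diag_res i).
Proof.
move=> A B; apply: diag_resE; rewrite rmorphB !mxE.
by apply: residueB; apply: diag_residue.
Qed.

(** A diagonal entry of A B is the product of the diagonal entries plus a cross term, which vanishes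
    at 0: one factor is regular there and the other is an upper right entry. *)
Lemma diag_res_monoid_morphism i : monoid_morphism (diag_res i).
Proof.
split=> [|A B]; apply: diag_resE.
  by rewrite rmorph1 mxE eqxx; apply: residue1.
rewrite rmorphM mulmx2E; have rA := diag_residue _ A; have rB := diag_residue _ B.
have [a ra] := local_residue10 A; have [b rb] := local_residue10 B.
case: (ord2P i) => ->.
  have := residueD (residueM (rA 0) (rB 0)) (residueM (local_residue01 A) rb).
  by rewrite mul0r addr0.
have := residueD (residueM ra (local_residue01 B)) (residueM (rA 1) (rB 1)).
by rewrite mulr0 add0r.
Qed.

Lemma diag_resZ i a (A : local_alg) : diag_res i (a *: A) = a * diag_res i A.
Proof.
apply: diag_resE; rewrite linearZ ratmx_scaleE.
have := residueM (residue_poly a%:P) (diag_residue i A); rewrite hornerC.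
exact.
Qed.

HB.instance Definition _ i := GRing.isZmodMorphism.Build _ _ (diag_res i)
  (diag_res_zmod_morphism i).
HB.instance Definition _ i := GRing.isMonoidMorphism.Build _ _ (diag_res i)
  (diag_res_monoid_morphism i).

(** At 0 the determinant takes the value k l, which is nonzero; so its inverse is regular at 0, and
    the adjugate formula gives an inverse that stays in the subalgebra. In particular, elements
    killed by both [diag_res] lie in the radical. *)
Lemma local_unit (A : local_alg) : diag_res 0 A != 0 -> diag_res 1 A != 0 ->
  exists B, B * A = 1 /\ A * B = 1.
Proof.
move=> k0 l0; have rk := diag_residue 0 A; have rl := diag_residue 1 A.
have [m rm] := local_residue10 A; have rz := local_residue01 A.
move: k0 l0 rk rl; set k := diag_res 0 A; set l := diag_res 1 A => k0 l0 rk rl.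
have rd : residue (det2 (local_incl A)) (k * l).
  by have := residueB (residueM rk rl) (residueM rz rm); rewrite mul0r subr0.
have kl0 : k * l != 0 by rewrite mulf_neq0.
have d0 : det2 (local_incl A) != 0.
  by apply: contraNneq kl0 => d0; apply/eqP/(residue_fun rd); rewrite d0; apply: residue0.
have rV := residueV kl0 rd.
have BP : (inv2 (local_incl A) : ratmx) \in local_mx.
  apply/local_mxP; exists (l / (k * l)), (k / (k * l)), (0 - m / (k * l)).
  rewrite !mx2E; split; try exact: residueM.
    by rewrite -[- _]sub0r; apply: residueB (residue0 _) _; apply: residueM.
  rewrite -[- _]sub0r; have := residueB (residue0 _) (residueM rz rV).
  by rewrite mul0r subr0.
exists (mk_local BP); split; apply: val_inj; rewrite rmorphM rmorph1.
  exact: mulVmx2.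
exact: mulmx2V.
Qed.

Lemma local_mx2 a b c d k l m : residue a k -> residue b 0 -> residue c m ->
  residue d l -> (mx2 a b c d : ratmx) \in local_mx.
Proof. by move=> ra rb rc rd; apply/local_mxP; exists k, l, m; rewrite !mx2E. Qed.

(** The idempotent P; [proj2] is Q. *)
Definition proj1 : local_alg :=
  mk_local (local_mx2 (residue1 K) (residue0 K) (residue0 K) (residue0 K)).

Lemma residueX : residue 'X%:F (0 : K).
Proof. by rewrite -[X in residue _ X](hornerX 0); apply: residue_poly. Qed.

Lemma residue1X : residue (1 - 'X%:F) (1 : K).
Proof. by have := residueB (residue1 K) residueX; rewrite subr0. Qed.

Definition proj2 : local_alg :=
  mk_local (local_mx2 residue1X residueX residue1X residueX).

Lemma local_inclE a b c d (h : (mx2 a b c d : ratmx) \in local_mx) :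
  local_incl (mk_local h) = mx2 a b c d.
Proof. by []. Qed.

Lemma proj1_idem : proj1 * proj1 = proj1.
Proof.
apply: val_inj; rewrite rmorphM -[\val proj1]/(mx2 1 0 0 0 : ratmx).
by apply: mx2P; rewrite mulmx2E !mx2E; ring.
Qed.

Lemma proj2_idem : proj2 * proj2 = proj2.
Proof.
apply: val_inj; rewrite rmorphM.
rewrite -[\val proj2]/(mx2 (1 - 'X%:F) 'X%:F (1 - 'X%:F) 'X%:F : ratmx).
by apply: mx2P; rewrite mulmx2E !mx2E; ring.
Qed.

Lemma diag_res_proj1 : (diag_res 0 proj1 = 1) * (diag_res 1 proj1 = 0).
Proof.
by split; apply: diag_resE; rewrite local_inclE mx2E; [apply: residue1|apply: residue0].
Qed.

(** These are the same values as for [proj1], which is why f and g induce the same map on V. *)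
Lemma diag_res_proj2 : (diag_res 0 proj2 = 1) * (diag_res 1 proj2 = 0).
Proof.
by split; apply: diag_resE; rewrite local_inclE mx2E; [apply: residue1X|apply: residueX].
Qed.

End Algebras.

(** * Computation of V *)

Section FieldV.
Variable F : fieldType.

(** The case of [V_ind] with radical 0 and the single generator 1, measured by the rank. *)
Lemma field_V_ind (P : V F -> Prop) : P 0 ->
  (forall u, P u -> P (V_unit F + u)) -> forall u, P u.
Proof.
rewrite /V_unit idem1E => P0 PD.
apply: (@V_ind F unit (fun=> 1) (eq^~ 0) (fun=> mulr1 1) _ _ _ _ (@V_rank F)) => //.
- by move=> x y -> ->; rewrite addr0.
- by move=> x y ->; rewrite mulr0.
- by move=> x ->; exists 1; rewrite subr0 mulr1.
- by move=> x /eqP x0; exists tt, x^-1, 1; rewrite mulVf ?mulr1.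
- exact: raddfD.
- by move=> _; rewrite -[_ (mulr1 1)]idem1E [V_rank _]V_rank_unit.
Qed.

Lemma exchange_field : exchange_ring F.
Proof.
move=> x; have [->|x0] := eqVneq x 0.
  by exists 0, 0, 0; rewrite !mulr0 addr0 subr0.
by exists 1, x^-1, 1; rewrite mulr1 mulVf // mul1r addrC addKr.
Qed.

End FieldV.

(** * Semilocal rings with two places: V and the exchange property *)

Section TwoPlaces.
(** Treats B and C together: invertibility is detected by two morphisms to a field, and p lifts the
    idempotent (1, 0). *)
Variables (R : pzRingType) (F : fieldType) (phi psi : {rmorphism R -> F}) (p : R).
Hypotheses (pp : p * p = p) (phi_p : phi p = 1) (psi_p : psi p = 0).
Hypothesis units : forall x, phi x != 0 -> psi x != 0 ->
  exists y, y * x = 1 /\ x * y = 1.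

Let corner b : R := if b then p else 1 - p.

Lemma corner_idem b : corner b * corner b = corner b.
Proof.
case: b; rewrite // /corner mulrBl mul1r mulrBr mulr1 pp subrr subr0 //.
Qed.

Lemma corner_orth b : corner b * corner (~~ b) = 0.
Proof. by case: b; rewrite /corner /= ?mulrBl ?mulrBr ?mulr1 ?mul1r pp subrr. Qed.

Lemma corner_sum b : corner b + corner (~~ b) = 1.
Proof. by case: b; rewrite /corner /= ?subrK // addrC subrK. Qed.

Lemma phi_corner b : phi (corner b) = b%:R.
Proof. by case: b; rewrite /corner ?rmorphB ?rmorph1 phi_p ?subrr. Qed.

Lemma psi_corner b : psi (corner b) = (~~ b)%:R.
Proof. by case: b; rewrite /corner ?rmorphB ?rmorph1 psi_p ?subr0. Qed.

(** With c = [corner b] and d its complement, c x c + d is nonzero at both places, hence has an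
    inverse w. Multiplying w (c x c + d) = 1 on the right by c gives w c x c = c. *)
Lemma corner_unit b x : (if b then phi x else psi x) != 0 ->
  exists y z, y * x * z = corner b.
Proof.
move=> x0; set c := corner b; set d := corner (~~ b).
have cc : c * c = c by apply: corner_idem.
have cd : c * d = 0 by apply: corner_orth.
have dc : d * c = 0 by rewrite /c /d -{2}[b]negbK corner_orth.
have [|| w [wu _]] := units (x := c * x * c + d).
- rewrite rmorphD !rmorphM !phi_corner; case: b x0 {c d cc cd dc} => x0.
    by rewrite addr0 mulr1 mul1r.
  by rewrite mulr0 add0r oner_neq0.
- rewrite rmorphD !rmorphM !psi_corner; case: b x0 {c d cc cd dc} => x0.
    by rewrite mulr0 add0r oner_neq0.
  by rewrite addr0 mulr1 mul1r.
exists (w * c), c.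
by rewrite -[RHS]mul1r -wu -[RHS]mulrA mulrDl dc addr0 -!mulrA cc.
Qed.

Let classes b : V R := Vclass (idem_elt (corner_idem b)).

Lemma V_rank2_classes b : V_rank2 phi psi (classes b) = (b : nat, ~~ b : nat).
Proof.
rewrite /V_rank2; case: b => /=; congr pair.
- by apply: V_rank_map1; rewrite phi_corner.
- by apply: V_rank_map0; rewrite psi_corner.
- by apply: V_rank_map0; rewrite phi_corner.
- by apply: V_rank_map1; rewrite psi_corner.
Qed.

Lemma two_places_ind (P : V R -> Prop) : P 0 ->
  (forall b u, P u -> P (classes b + u)) -> forall u, P u.
Proof.
move=> P0 PD.
(* The radical is the common kernel of the places, and the measure is the sum of the two ranks,
   which is 1 on each generator. *)
apply: (@V_ind R bool corner (fun x => phi x = 0 /\ psi x = 0) corner_idem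
          _ _ _ _ (Lu_h \o V_rank2 phi psi)) => //.
- by move=> x y [a b] [c d]; rewrite !rmorphD a b c d addr0.
- by move=> x y [a b]; rewrite !rmorphM a b !mulr0.
- move=> x [a b]; have [||y [yx _]] := units (x := 1 - x).
  + by rewrite rmorphB rmorph1 a subr0 oner_neq0.
  + by rewrite rmorphB rmorph1 b subr0 oner_neq0.
  by exists y.
- move=> x x0; have [x1|x1] := eqVneq (phi x) 0; last first.
    by have [y [z yz]] := corner_unit (b := true) x1; exists true, y, z.
  have [x2|x2] := eqVneq (psi x) 0; first by case: x0.
  by have [y [z yz]] := corner_unit (b := false) x2; exists false, y, z.
- by move=> u w; rewrite /= raddfD /Lu_h /= addnACA.
- by move=> b; rewrite /comp (V_rank2_classes b); case: b.
Qed.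

Lemma classes_sum : classes true + classes false = V_unit R.
Proof.
exact: Vclass_elt_compl (corner_orth true) (corner_orth false) (corner_sum true).
Qed.

Lemma two_places_iso : ounit_iso (V_unit R) (1, 1)%N (V_rank2 phi psi).
Proof.
split; last first.
  transitivity (V_rank2 phi psi (classes true) + V_rank2 phi psi (classes false)).
    by rewrite -raddfD classes_sum.
  by rewrite !V_rank2_classes.
apply: (bijective_nat2 (x := classes)) two_places_ind; exact: V_rank2_classes.
Qed.

(** The idempotent [c] is chosen to be 1 at the places where x is nonzero and 0 at the others. Then
    c x + (1 - c) (1 - x) takes at each place the value of x if that is nonzero and 1 otherwise, so
    it is a unit, as [exchange_at] requires. *)
Lemma two_places_exchange : exchange_ring R.
Proof.
move=> x; pose a := phi x != 0; pose b := psi x != 0.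
pose c := a%:R * p + b%:R * (1 - p).
have pq : p * (1 - p) = 0 := corner_orth true.
have cc : c * c = c.
  rewrite /c; case: (a); case: (b); rewrite ?mul1r ?mul0r ?addr0 ?add0r //.
  - by rewrite addrC subrK mulr1.
  - exact: (corner_idem false).
  - by rewrite mul0r.
have phi_c : phi c = a%:R.
  by rewrite rmorphD !rmorphM rmorphB rmorph1 phi_p subrr mulr0 addr0 mulr1 rmorph_nat.
have psi_c : psi c = b%:R.
  by rewrite rmorphD !rmorphM rmorphB rmorph1 psi_p subr0 mulr0 add0r mulr1 rmorph_nat.
have [||w [wu uw]] := units (x := c * x + (1 - c) * (1 - x)).
- rewrite rmorphD !rmorphM !rmorphB !rmorph1 phi_c /a.
  have [->|x0] := eqVneq (phi x) 0; first by rewrite !subr0 mulr1 mulr0 add0r oner_neq0.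
  by rewrite mul1r subrr mul0r addr0.
- rewrite rmorphD !rmorphM !rmorphB !rmorph1 psi_c /b.
  have [->|x0] := eqVneq (psi x) 0; first by rewrite !subr0 mulr1 mulr0 add0r oner_neq0.
  by rewrite mul1r subrr mul0r addr0.
exact: exchange_at cc wu uw.
Qed.

End TwoPlaces.

(** * V of the matrix ring M_2(F) *)

Section Matrix2V.
Variable F : fieldType.

Definition V_rank_mx2 (u : V 'M[F]_2) : nat := V_rank (Vflat u).

Lemma V_rank_mx2_nmod_morphism : nmod_morphism V_rank_mx2.
Proof. by split=> [|u w]; rewrite /V_rank_mx2 ?raddf0 ?raddfD. Qed.

HB.instance Definition _ := GRing.isNmodMorphism.Build (V 'M[F]_2) nat V_rank_mx2
  V_rank_mx2_nmod_morphism.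

Definition corner2 (b : bool) : 'M[F]_2 :=
  if b then mx2 1 0 0 0 else mx2 0 0 0 1.

Lemma corner2_idem b : corner2 b * corner2 b = corner2 b.
Proof. by case: b; apply: mx2P; rewrite mulmx2E !mx2E; ring. Qed.

Let classes b : V 'M[F]_2 := Vclass (idem_elt (corner2_idem b)).

(** The matrix units satisfy E_11 = E_10 E_01 and E_00 = E_01 E_10. *)
Lemma corner2_classes b : classes b = classes true.
Proof.
case: b => //; apply: (@Vclass_equiv _ _ _ (mx2 0 0 1 0) (mx2 0 1 0 0));
  by apply: mx2P; rewrite mulmx2E !mx2E; ring.
Qed.

(** It suffices to treat E_00, whose flattening has a single 1, at position (0, 0), and so
    represents the unit class over F. *)
Lemma V_rank_mx2_class b : V_rank_mx2 (classes b) = 1%N.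
Proof.
rewrite corner2_classes -[RHS](V_rank_unit F) /V_rank_mx2 Vflat_class /V_unit.
congr (V_rank (Vclass _)); rewrite idem1E; apply: idem_ext; apply: minf_ext => i j.
rewrite minf_flatE !minf_deltaE.
have p0 : parity 0 = 0 by apply: val_inj; rewrite /= inordK.
have p1 : parity 1 = 1 by apply: val_inj; rewrite /= inordK.
by case: i j => [|[|i]] [|[|j]] //=; rewrite ?p0 ?p1 ?mx2E // mxE.
Qed.

Lemma V_rank_mx2_unit : V_rank_mx2 (V_unit 'M[F]_2) = 2%N.
Proof.
have -> : V_unit 'M[F]_2 = classes true + classes false.
  by apply/esym/Vclass_elt_compl; apply: mx2P;
    rewrite ?mulmx2E ?mxE /=; ring.
by rewrite raddfD [X in X + _]V_rank_mx2_class [X in _ + X]V_rank_mx2_class.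
Qed.

Lemma mx2_V_ind (P : V 'M[F]_2 -> Prop) : P 0 ->
  (forall u, P u -> P (classes true + u)) -> forall u, P u.
Proof.
move=> P0 PD.
apply: (@V_ind _ unit (fun=> corner2 true) (eq^~ 0) (fun=> corner2_idem true)
          _ _ _ _ V_rank_mx2) => //.
- by move=> x y -> ->; rewrite addr0.
- by move=> x y ->; rewrite mulr0.
- by move=> x ->; exists 1; rewrite subr0 mulr1.
- move=> A A0; have [i [j Aij]] : exists i j, A i j != 0.
    apply: contrapT => nA; apply: A0; apply/matrixP => i j; rewrite mxE.
    by apply/eqP/negPn/negP => Aij; apply: nA; exists i, j.
  exists tt.
  (* A nonzero entry is moved to the corner and normalized: E_0i A E_j0 = A_ij E_00. *)
  exists (delta_mx 0 i : 'M_2), ((A i j)^-1 *: (delta_mx j 0 : 'M_2)).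
  by case: (ord2P i) Aij => ->; case: (ord2P j) => -> Aij; apply: mx2P;
    rewrite !mulmx2E !mxE /= ?(mulr0, mul0r, mulr1, mul1r, addr0, add0r) ?divff.
- exact: raddfD.
- by move=> _; rewrite (V_rank_mx2_class true).
Qed.

Lemma V_rank_mx2_iso : ounit_iso (V_unit 'M[F]_2) 2%N V_rank_mx2.
Proof.
split; last exact: V_rank_mx2_unit.
exact: bijective_nat (V_rank_mx2_class true) mx2_V_ind.
Qed.

End Matrix2V.

(** * The involution v of D *)

Section Flip.
Variable K : fieldType.
Local Notation F := {fraction {poly K}}.

Definition flip (A : ratmx K) : ratmx K :=
  mx2 (ratfun_reflect (A 1 1)) (ratfun_reflect (A 1 0))
      (ratfun_reflect (A 0 1)) (ratfun_reflect (A 0 0)).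

(** Linearity holds over K because t |-> 1 - t fixes the constants. *)
Lemma flip_linear : linear flip.
Proof.
move=> a A B.
have E (X Y : ratmx K) i j : (a *: X + Y) i j = (a%:P)%:F * X i j + Y i j by rewrite !mxE.
have aE : ratfun_reflect (a%:P)%:F = (a%:P)%:F by rewrite ratfun_reflectE comp_polyC.
by apply: mx2P; rewrite E /flip !mx2E E rmorphD rmorphM /= aE.
Qed.

Lemma flip_monoid_morphism : monoid_morphism flip.
Proof.
split=> [|A B].
  by rewrite /flip; apply: mx2P; rewrite mx2E !mx2_1E ?rmorph0 ?rmorph1.
by rewrite /flip; apply: mx2P; rewrite !mulmx2E !mx2E rmorphD !rmorphM addrC.
Qed.

HB.instance Definition _ := GRing.isLinear.Build K (ratmx K) (ratmx K) _ flip flip_linear.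
HB.instance Definition _ := GRing.isMonoidMorphism.Build _ _ flip flip_monoid_morphism.

Lemma flipK : involutive flip.
Proof. by move=> A; rewrite /flip; apply: mx2P; rewrite !mx2E ratfun_reflectK. Qed.

Lemma flip_proj1 : flip (local_incl (proj1 K)) = 1 - local_incl (proj1 K).
Proof.
by rewrite /flip; apply: mx2P; rewrite !mxE /= ?rmorph0 ?rmorph1 ?subr0 ?subrr.
Qed.

Lemma flip_proj2 : flip (local_incl (proj2 K)) = local_incl (proj2 K).
Proof.
have rX : ratfun_reflect 'X%:F = 1 - 'X%:F :> {fraction {poly K}}.
  by rewrite ratfun_reflectE comp_polyX tofracB tofrac1.
have r1X : ratfun_reflect (1 - 'X%:F) = 'X%:F :> {fraction {poly K}}.
  by rewrite -rX ratfun_reflectK.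
by rewrite /flip /proj2 local_inclE !mx2E rX r1X.
Qed.

End Flip.

(** * Effect of f, g, h and v on the ranks *)

Section Ranks.
Variable K : fieldType.

Local Notation local_rank := (@V_rank2 (local_alg K) K^o (diag_res 0) (diag_res 1)).

(** Followed by the places of C, the morphism attached to q gives the two coordinates of B; this
    covers f and g alike. *)
Lemma diag_res_idem_morph (q : local_alg K) (qq : q * q = q) x :
  diag_res 0 q = 1 -> diag_res 1 q = 0 ->
  diag_res 0 (idem_lrmorphism qq x) = x.1 /\
  diag_res 1 (idem_lrmorphism qq x) = x.2.
Proof.
move=> q0 q1.
have E i : diag_res i (idem_lrmorphism qq x) =
    x.1 * diag_res i q + x.2 * (1 - diag_res i q).
  by rewrite [idem_lrmorphism _ _]/= rmorphD /= !diag_resZ rmorphB rmorph1.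
by rewrite !E q0 q1 subrr subr0 !mulr0 !mulr1 addr0 add0r.
Qed.

Lemma local_rank_idem_morph (q : local_alg K) (qq : q * q = q) u :
  diag_res 0 q = 1 -> diag_res 1 q = 0 ->
  local_rank (Vmap (idem_lrmorphism qq) u) = @V_rank2 (K^o * K^o)%type K^o fst snd u.
Proof.
by move=> q0 q1; apply: V_rank2_map => x; have [] := diag_res_idem_morph qq x q0 q1.
Qed.

(** Checked on the generators: the inclusion sends P and 1 - P to E_00 and E_11, each of rank 1 in
    D. *)
Lemma local_incl_rank u :
  V_rank_mx2 (Vmap (@local_incl K) u) = Lu_h (local_rank u).
Proof.
have [h0 h1] := diag_res_proj1 K.
elim/(two_places_ind (pp := proj1_idem K) h0 h1 (@local_unit K)): u => [|b u IH].
  by rewrite !raddf0.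
have bE : local_incl (if b then proj1 K else 1 - proj1 K) = corner2 _ b.
  case: b; first by apply: mx2P; rewrite local_inclE.
  rewrite rmorphB rmorph1 /= local_inclE.
  by apply: mx2P; rewrite !mxE /= ?subr0 ?subrr.
set c := Vclass _.
have hV : V_rank_mx2 (Vmap (@local_incl K) c) = 1%N.
  by rewrite (Vmap_elt _ (corner2_idem _ b) bE) (V_rank_mx2_class _ b).
have hR : Lu_h (local_rank c) = 1%N.
  by rewrite (V_rank2_classes (proj1_idem K) h0 h1); case: (b).
have LD x y : Lu_h (x + y) = (Lu_h x + Lu_h y)%N by rewrite /Lu_h /= addnACA.
rewrite !raddfD LD; congr addn; last exact: IH.
exact: etrans hV (esym hR).
Qed.

(** V(D) is generated by the class of E_00, which the involution sends to the equivalent idempotent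
    E_11. *)
Lemma flip_rank u : V_rank_mx2 (Vmap (@flip K) u) = V_rank_mx2 u.
Proof.
elim/mx2_V_ind: u => [|u IH]; first by rewrite !raddf0.
have fE : flip (corner2 _ true) = corner2 _ false :> ratmx K.
  by rewrite /flip /corner2; apply: mx2P; rewrite !mx2E ?rmorph0 ?rmorph1.
have fC := Vmap_elt (corner2_idem _ true) (corner2_idem _ false) fE.
rewrite !raddfD; congr addn; last exact: IH.
exact: etrans (congr1 (@V_rank_mx2 _) fC)
  (congr1 (@V_rank_mx2 _) (corner2_classes _ false)).
Qed.

End Ranks.

Theorem theorem11p2 (K : fieldType) :
  exists (A B C D : algType K)
    (e : {lrmorphism A -> B}) (s : {lrmorphism B -> B})
    (f g : {lrmorphism B -> C}) (h : {lrmorphism C -> D})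
    (v : {lrmorphism D -> D}),
  [/\ exchange_ring A, exchange_ring B, exchange_ring C & exchange_ring D] /\
  [/\ f \o e =1 g \o e,
      s \o e =1 e,
      h \o f \o s =1 v \o h \o f &
      v \o h \o g =1 h \o g] /\
  (involutive s /\ involutive v) /\
  exists (eta_A : {additive V A -> nat})
    (eta_B : {additive V B -> (nat * nat)%type})
    (eta_C : {additive V C -> (nat * nat)%type})
    (eta_D : {additive V D -> nat}),
  [/\ ounit_iso (V_unit A) 1%N eta_A,
      ounit_iso (V_unit B) (1%N, 1%N) eta_B,
      ounit_iso (V_unit C) (1%N, 1%N) eta_C &
      ounit_iso (V_unit D) 2%N eta_D] /\
  (eta_B \o Vmap e =1 Lu_e \o eta_A) /\
  (eta_B \o Vmap s =1 Lu_s \o eta_B) /\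
  (eta_C \o Vmap f =1 eta_B) /\
  (eta_C \o Vmap g =1 eta_B) /\
  (eta_D \o Vmap h =1 Lu_h \o eta_C) /\
  (eta_D \o Vmap v =1 eta_D).
Proof.
pose f := idem_lrmorphism (proj1_idem K); pose g := idem_lrmorphism (proj2_idem K).
exists K^o, (K^o * K^o)%type, (local_alg K), (ratmx K).
exists (@diag K : {lrmorphism _ -> _}), (@swap K : {lrmorphism _ -> _}).
exists f, g.
exists (@local_incl K : {lrmorphism _ -> _}), (@flip K : {lrmorphism _ -> _}).
have Bunits (x : K^o * K^o) : x.1 != 0 -> x.2 != 0 ->
    exists y, y * x = 1 /\ x * y = 1.
  case: x => a b /= a0 b0; exists (a^-1, b^-1).
  by split; congr pair; rewrite /= ?mulVf ?mulfV.
pose p : K^o * K^o := (1, 0).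
have pp : p * p = p by congr pair; rewrite /= ?mulr1 ?mulr0.
have inclE q (qq : q * q = q) x : local_incl (idem_lrmorphism qq x) =
    x.1 *: local_incl q + x.2 *: (1 - local_incl q).
  by rewrite [idem_lrmorphism _ _]/= linearD !linearZ /= rmorphB rmorph1.
have flipE q x : flip (x.1 *: local_incl q + x.2 *: (1 - local_incl q)) =
    x.1 *: flip (local_incl q) + x.2 *: (1 - flip (local_incl q)) :> ratmx K.
  by rewrite linearD !linearZ /= rmorphB rmorph1.
split.
  split.
  - exact: exchange_field.
  - exact: (@two_places_exchange _ _ fst snd p).
  - exact: (two_places_exchange (proj1_idem K) (diag_res_proj1 K).1
      (diag_res_proj1 K).2 (@local_unit K)).
  - exact: exchange_mx2.
split.
  split.
  (* On (a, a) both morphisms give the scalar a, because q + (1 - q) = 1 for q = P and for q = Q. *)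
  - by move=> a; rewrite /= /idem_morph -!scalerDr !subrKC.
  - by [].
  (* Since v(P) = 1 - P, applying v exchanges the two coefficients of x_1 P + x_2 (1 - P). *)
  - move=> x; rewrite -[LHS]/(local_incl (f (swap x))) -[RHS]/(flip (local_incl (f x))).
    by rewrite !inclE flipE flip_proj1 subKr addrC.
  (* Since v(Q) = Q, the image of g is fixed. *)
  - move=> x; rewrite -[LHS]/(flip (local_incl (g x))) -[RHS]/(local_incl (g x)).
    by rewrite !inclE flipE flip_proj2.
split; first by split; [case|exact: flipK].
exists (@V_rank K^o), (V_rank2 fst snd),
  (@V_rank2 (local_alg K) K^o (diag_res 0) (diag_res 1)),
  (@V_rank_mx2 _).
split.
  split.
  - split; last exact: V_rank_unit.
    exact: bijective_nat (V_rank_unit _) (@field_V_ind _).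
  - exact: (@two_places_iso _ _ fst snd p).
  - exact: (two_places_iso (proj1_idem K) (diag_res_proj1 K).1
      (diag_res_proj1 K).2 (@local_unit K)).
  - exact: V_rank_mx2_iso.
split=> [u|].
  (* Each coordinate of the diagonal map is the identity of K. *)
  transitivity (@V_rank2 K^o K^o idfun idfun u); first exact: V_rank2_map.
  by rewrite /V_rank2 Vmap_id.
split=> [u|]; first exact: (V_rank2_map (phi' := snd) (psi' := fst)).
split=> [u|].
  exact: (local_rank_idem_morph _ _ (diag_res_proj1 K).1 (diag_res_proj1 K).2).
split=> [u|].
  exact: (local_rank_idem_morph _ _ (diag_res_proj2 K).1 (diag_res_proj2 K).2).
by split=> u; [apply: local_incl_rank|apply: flip_rank].
Qed.
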